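(* Let $(M,L)$ and $(M,\widetilde L)$ be two Finsler manifolds on the same manifold $M$, with canonical sprays $G,\widetilde G$, Barthel connections $\Gamma,\widetilde\Gamma$ and Berwald connections $D^{\circ},\widetilde D^{\circ}$ respectively. The following assertions are equivalent (in each of them $\lambda$ denotes a function on $TM$ which is positively homogeneous of degree $1$ in the directional argument $y$): (a) $(M,L)$ and $(M,\widetilde L)$ are projectively related, i.e. $\widetilde G=G-2\lambda\,\mathcal C$ for some such $\lambda$. (b) For some such $\lambda$, $\ \widetilde\Gamma=\Gamma-2\{\lambda J+d_J\lambda\otimes\mathcal C\}$. (c) For some such $\lambda$, with $\alpha(\overline X):=d_J\lambda(\beta\overline X)$, $$\widetilde D^{\circ}_{X}\overline Y=D^{\circ}_{X}\overline Y+\alpha(\overline Y)\,\rho X+\alpha(\rho X)\,\overline Y+(\stackrel{2}{D^{\circ}}\alpha)(\overline Y,\rho X)\,\overline\eta$$ for all vector fields $X$ on $\mathcal TM$ and all $\pi$-vector fields $\overline Y$.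
   Context: $M$ is a real paracompact $C^\infty$ manifold of dimension $n$; $\pi:\mathcal TM\to M$ is the bundle of nonzero tangent vectors; $\pi^{-1}(TM)\to\mathcal TM$ is the pullback of $TM$ by $\pi$. Sections of $\pi^{-1}(TM)$ are called $\pi$-vector fields and written $\overline X$; tensor fields on $\pi^{-1}(TM)$ are called $\pi$-tensor fields (scalar-valued covariant ones: $\pi$-forms). $\overline\eta$ is the $\pi$-vector field $\overline\eta(u)=(u,u)$. There is an exact sequence $0\to\pi^{-1}(TM)\xrightarrow{\gamma}T(\mathcal TM)\xrightarrow{\rho}\pi^{-1}(TM)\to0$, where $\gamma$ is the vertical lift $\gamma(u,w)=\frac{d}{dt}\big|_{t=0}(u+tw)$ and $\rho$ sends $X\in T_u(\mathcal TM)$ to $(u,d\pi(X))$. Put $J:=\gamma\circ\rho$ and $\mathcal C:=\gamma\circ\overline\eta$. For a function $f$, $d_Jf(X)=(JX)\cdot f$. For a Finsler manifold $(M,L)$ with $E=\frac12L^2$: the canonical spray $G$ is the vector field with $i_G\,dd_JE=-dE$; the Barthel connection is $\Gamma=[J,G]$, i.e. $\Gamma(X)=[JX,G]-J[X,G]$; $h=\frac12(I+\Gamma)$, $v=\frac12(I-\Gamma)$. The horizontal map $\beta:\pi^{-1}(TM)\to T(\mathcal TM)$ sends $\overline X$ to the unique vector in the image of $h$ with $\rho(\beta\overline X)=\overline X$; $K:T(\mathcal TM)\to\pi^{-1}(TM)$ is determined by $\gamma\circ K=v$. The Berwald connection $D^\circ$ is the linear connection on $\pi^{-1}(TM)$ with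 $D^\circ_{\gamma\overline X}\overline Y=\rho[\gamma\overline X,\beta\overline Y]$ and $D^\circ_{\beta\overline X}\overline Y=K[\beta\overline X,\gamma\overline Y]$. For a $\pi$-tensor field $A$, $(\stackrel{2}{D^\circ}A)(\overline X,\overline Y,\dots):=(D^\circ_{\gamma\overline X}A)(\overline Y,\dots)$. Projectively related means: the canonical sprays satisfy $\widetilde G=G-2\lambda\mathcal C$ for a function $\lambda$ on $TM$ (smooth on $\mathcal TM$) positively homogeneous of degree 1 in $y$. (This is equivalent to having the same geodesics up to parametrization, and is taken as the definition.) Tilded objects are those of $(M,\widetilde L)$; note $\alpha(\overline X)=(\gamma\overline X)\cdot\lambda$. *)

(* Defs.v *)
From HB Require Import structures.
From mathcomp Require Import all_boot all_order all_algebra.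
From mathcomp Require Import all_classical all_reals all_analysis.

Set Implicit Arguments.
Unset Strict Implicit.
Unset Printing Implicit Defensive.

Import Order.TTheory GRing.Theory Num.Theory.
Import numFieldNormedType.Exports.

Local Open Scope classical_set_scope.
Local Open Scope ring_scope.

Section SmoothFunctions.
Context {R : realType} {E : normedModType R}.
Implicit Types (U : set E) (f : E -> R).

Fixpoint Ck (k : nat) U f : Prop :=
  match k with
  | 0 => forall x, U x -> {for x, continuous f}
  | k'.+1 => (forall x, U x -> differentiable f x) /\
             (forall v, Ck k' U ('D_v f))
  end.

Definition Coo U f := forall k, Ck k U f.

End SmoothFunctions.

(* An atlas is a set of charts.  The notions of this section use only the
   charts, not a topology on N, so that they apply verbatim to a manifold and
   to its slit tangent bundle. *)
Record chart (R : realType) (E : normedModType R) (N : Type) :=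
  Chart { cdom : set N ; cmap :> N -> E }.

Section Charts.
Context {R : realType} {E : normedModType R} {N : Type}.
Implicit Types (c : chart E N) (A : set (chart E N)) (p : N) (f : N -> R).

(* The local representation f o c^-1, extended by 0 outside c(dom c). *)
Definition lrep c f : E -> R :=
  fun x => xget 0 [set f p | p in cdom c `&` [set p | c p = x]].

Definition smooth_at A p f :=
  exists c, [/\ A c, cdom c p &
    exists U : set E,
      [/\ open U, U (c p), U `<=` c @` cdom c & Coo U (lrep c f)]].

Definition smooth A f := forall p, smooth_at A p f.

(* An operator given on the functions that are smooth near p, extended by 0
   to all functions.  Vectors at p are operators of this shape, so that two of
   them are equal as soon as they agree on the functions smooth near p. *)
Definition on_smooth A p (D : (N -> R) -> R) : (N -> R) -> R :=
  fun f => if `[< smooth_at A p f >] then D f else 0.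

(* T_p N: the operators sum_i v^i (d/dx^i)|_p, for a chart c around p. *)
Definition tangent A p : set ((N -> R) -> R) :=
  [set X | exists c, [/\ A c, cdom c p &
    exists v : E, X = on_smooth A p (fun f => 'D_v (lrep c f) (c p))]].

(* X . f *)
Definition der {K : Type} (X : K -> (N -> R) -> R) f : K -> R :=
  fun u => X u f.

Definition lie A (X Y : N -> (N -> R) -> R) : N -> (N -> R) -> R :=
  fun p => on_smooth A p (fun f => X p (der Y f) - Y p (der X f)).

End Charts.

(* The smooth sections along g : K -> N of the tangent bundle of N, i.e. of
   the pullback g^-1(TN).  Smoothness is tested on locally defined functions,
   hence in particular on coordinates. *)
Definition field_along (R : realType) (E F : normedModType R) (K N : Type)
    (B : set (chart E K)) (A : set (chart F N)) (g : K -> N) :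
    set (K -> (N -> R) -> R) :=
  [set X | forall u, tangent A (g u) (X u) /\
     forall f, smooth_at A (g u) f -> smooth_at B u (der X f)].

(* f X *)
Definition fscale (R : realType) (K : Type) (V : lmodType R)
  (f : K -> R) (X : K -> V) : K -> V := fun u => f u *: X u.

Definition paracompact (T : topologicalType) :=
  forall F : set (set T), F `<=` open -> \bigcup_(U in F) U = setT ->
  exists G : set (set T),
    [/\ G `<=` open, \bigcup_(V in G) V = setT,
        forall V, G V -> exists2 U, F U & V `<=` U &
        forall x : T, exists2 W, nbhs x W &
          finite_set [set V | G V /\ V `&` W !=set0]].

Definition smooth_atlas (R : realType) (n : nat) (M : topologicalType)
    (A : set (chart 'rV[R]_n M)) :=
  [/\ forall p, exists2 c, A c & cdom c p,
      forall c, A c ->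
        [/\ open (cdom c), {in cdom c &, injective c},
            {in cdom c, continuous c} &
            forall V, open V -> V `<=` cdom c -> open (c @` V)] &
      forall c d, A c -> A d -> forall i,
        Coo (c @` (cdom c `&` cdom d)) (lrep c (fun q => d q 0 i))].

Definition smooth_manifold (R : realType) (n : nat) (M : topologicalType)
    (A : set (chart 'rV[R]_n M)) :=
  [/\ hausdorff_space M, paracompact M & smooth_atlas A].

Record tbundle (R : realType) (n : nat) (M : topologicalType)
    (A : set (chart 'rV[R]_n M)) := TVec {
  tbase : M ;
  tvec : (M -> R) -> R ;
  tvecP : tangent A tbase tvec }.

Record slit (R : realType) (n : nat) (M : topologicalType)
    (A : set (chart 'rV[R]_n M)) := Slit {
  slit_val :> tbundle A ;
  slit_neq0 : tvec slit_val <> 0 }.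

Section SlitTangentBundle.
Context {R : realType} {n : nat} {M : topologicalType}.
Variable A : set (chart 'rV[R]_n M).

Local Notation TM := (tbundle A).
Local Notation sTM := (slit A).

Definition bproj (u : sTM) : M := tbase u.

(* The chart (x^i, y^i) of the slit tangent bundle induced by a chart (x^i)
   of M: y^i is the value of the vector on the coordinate function x^i. *)
Definition slit_chart (c : chart 'rV[R]_n M) :
    chart ('rV[R]_n * 'rV[R]_n)%type sTM :=
  {| cdom := [set u | cdom c (bproj u)] ;
     cmap := fun u => (c (bproj u), \row_i tvec u (fun q => c q 0 i)) |}.

Definition slit_atlas : set (chart ('rV[R]_n * 'rV[R]_n)%type sTM) :=
  slit_chart @` A.

Definition vfield := field_along slit_atlas slit_atlas id.

Definition pvfield := field_along slit_atlas A bproj.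

Implicit Types (X Y : sTM -> (sTM -> R) -> R) (P Q : sTM -> (M -> R) -> R).

(* t |-> f (u + t w), with value 0 for the t such that u + t w = 0; near
   t = 0 there is no such t. *)
Definition fibre_line (f : sTM -> R) (u : sTM) (w : (M -> R) -> R) (t : R) : R :=
  xget 0 [set f u' | u' in
    [set u' : sTM | bproj u' = bproj u /\ tvec u' = tvec u + t *: w]].

(* gamma (u, w) = d/dt (u + t w) at t = 0 *)
Definition vlift (u : sTM) (w : (M -> R) -> R) : (sTM -> R) -> R :=
  on_smooth slit_atlas u (fun f => derive1 (fibre_line f u w) 0).

Definition gamma P : sTM -> (sTM -> R) -> R := fun u => vlift u (P u).

(* rho is the differential of the bundle projection. *)
Definition rho X : sTM -> (M -> R) -> R :=
  fun u => on_smooth A (bproj u) (fun f => X u (f \o bproj)).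

Definition eta : sTM -> (M -> R) -> R := fun u => tvec u.

Definition Jend X := gamma (rho X).

Definition liouville := gamma eta.

Definition dJ (f : sTM -> R) X : sTM -> R := der (Jend X) f.

Definition bracket := lie slit_atlas.

(* exterior derivative of a 1-form, normalized without a factor 1/2 *)
Definition dform (w : (sTM -> (sTM -> R) -> R) -> sTM -> R) X Y : sTM -> R :=
  der X (w Y) - der Y (w X) - w (bracket X Y).

Definition poshom1 (f : TM -> R) :=
  forall (t : R) (u u' : TM), 0 < t ->
    tbase u' = tbase u -> tvec u' = t *: tvec u -> f u' = t * f u.

Definition restr (f : TM -> R) : sTM -> R := fun u => f u.

Definition smooth_poshom1 (f : TM -> R) :=
  smooth slit_atlas (restr f) /\ poshom1 f.

Section Finsler.
Variable L : TM -> R.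

Definition energy : sTM -> R := fun u => 2^-1 * L u ^+ 2.

Definition fundamental_form := dform (dJ energy).

(* Every tangent vector of the slit tangent bundle is a value of a vector
   field, so the last clause says that the fundamental form has maximal rank
   at each point.  Continuity of L on TM, with L = 0 on the zero section,
   follows from homogeneity. *)
Definition finsler :=
  [/\ smooth_poshom1 L, forall u : sTM, 0 < L u &
      forall u X, vfield X -> X u <> 0 ->
        exists2 Y, vfield Y & fundamental_form X Y u <> 0].

Definition canonical_spray (G : sTM -> (sTM -> R) -> R) :=
  vfield G /\ forall X, vfield X -> fundamental_form G X = - der X energy.

End Finsler.

Section Connections.
Variable G : sTM -> (sTM -> R) -> R.

Definition barthel X := bracket (Jend X) G - Jend (bracket X G).

Definition hproj X := 2^-1 *: (X + barthel X).
Definition vproj X := 2^-1 *: (X - barthel X).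

Definition beta P : sTM -> (sTM -> R) -> R :=
  xget 0 [set B | (exists2 X, vfield X & B = hproj X) /\ rho B = P].

Definition Kmap X : sTM -> (M -> R) -> R :=
  xget 0 [set P | pvfield P /\ gamma P = vproj X].

Definition linear_connection
    (D : (sTM -> (sTM -> R) -> R) -> (sTM -> (M -> R) -> R) ->
         sTM -> (M -> R) -> R) :=
  [/\ forall X P, vfield X -> pvfield P -> pvfield (D X P),
      forall X Y P, vfield X -> vfield Y -> pvfield P ->
        D (X + Y) P = D X P + D Y P,
      forall f X P, smooth slit_atlas f -> vfield X -> pvfield P ->
        D (fscale f X) P = fscale f (D X P),
      forall X P Q, vfield X -> pvfield P -> pvfield Q ->
        D X (P + Q) = D X P + D X Q &
      forall f X P, smooth slit_atlas f -> vfield X -> pvfield P ->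
        D X (fscale f P) = fscale (der X f) P + fscale f (D X P)].

Definition berwald D :=
  linear_connection D /\
  forall P Q, pvfield P -> pvfield Q ->
    D (gamma P) Q = rho (bracket (gamma P) (beta Q)) /\
    D (beta P) Q = Kmap (bracket (beta P) (gamma Q)).

End Connections.

(* The covariant derivative of the pi-form a along gamma P, evaluated at Q. *)
Definition vcov (D : (sTM -> (sTM -> R) -> R) -> (sTM -> (M -> R) -> R) ->
                     sTM -> (M -> R) -> R)
    (a : (sTM -> (M -> R) -> R) -> sTM -> R) P Q : sTM -> R :=
  der (gamma P) (a Q) - a (D (gamma P) Q).

Definition projectively_related (G Gt : sTM -> (sTM -> R) -> R) :=
  exists2 l, smooth_poshom1 l &
    Gt = G - 2 *: fscale (restr l) liouville.

Definition barthel_projective (G Gt : sTM -> (sTM -> R) -> R) :=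
  exists2 l, smooth_poshom1 l &
    forall X, vfield X ->
      barthel Gt X = barthel G X -
        2 *: (fscale (restr l) (Jend X) + fscale (dJ (restr l) X) liouville).

Definition berwald_projective G
    (D Dt : (sTM -> (sTM -> R) -> R) -> (sTM -> (M -> R) -> R) ->
            sTM -> (M -> R) -> R) :=
  exists2 l, smooth_poshom1 l &
    let alpha P := dJ (restr l) (beta G P) in
    forall X P, vfield X -> pvfield P ->
      Dt X P = D X P + fscale (alpha P) (rho X) + fscale (alpha (rho X)) P +
               fscale (vcov D alpha P (rho X)) eta.

End SlitTangentBundle.

(* Main.v *)
From HB Require Import structures.
Require Import Defs.
From mathcomp Require Import all_boot all_order all_algebra.
From mathcomp Require Import all_classical all_reals all_analysis.
From mathcomp Require Import ring lra.

(** The functions f o pi and dot f : u |-> u . f on the slit tangent bundle, for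
f a smooth function on M, include the coordinates of the induced charts, so a
vector field on the bundle is known once it is known on them.  The operators of
the theorem act on these functions by very short formulas: gamma P kills f o pi
and sends dot f to P . f, and (rho X) . f is X . (f o pi).  Hence the vanishing
of the Nijenhuis tensor of J (bracket_Jend), the homogeneity of J
(bracket_liouville_Jend) and the formula rho [gamma P, Y] = vder P (rho Y)
(rho_bracket_gamma) are verified by evaluation.  The main computation in
coordinates is that the bracket of two fields is again a field (lie_field),
which is the symmetry of second derivatives (Schwarz).

Nondegeneracy of the fundamental form turns i_G Omega = - dE into J G = C and
[C, G] = G.  The first equation gives rho [gamma P, G] = P, so that every
pi-vector field has a global lift and Gamma = [J, G] is an involution whose
eigenspace for -1 is the vertical bundle; this yields the maps beta and K
(betaP, KmapP).  The second gives [C, Gamma X] = Gamma [C, X] and, with it,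
D_X eta = K X (berwald_eta).

Let S P = lambda P + alpha(P) eta with alpha(P) = (gamma P) . lambda.
- (a) => (b): [J, lambda C] = lambda J + d_J lambda (x) C.
- (b) => (a): Gamma G = G, while the vertical field Gt - G is reversed by the
  Barthel connection of Gt; evaluating (b) on G gives Gt = G - 2 lambda C.
- (b) => (c): (b) says that K changes by S o rho, so beta changes by - gamma S.
  The Berwald derivative is vder (K X) P + K [beta (rho X), gamma P], and
  inserting both changes adds vder P (S (rho X)) - S (vder P (rho X)), which by
  the Leibniz rule is what (c) adds.
- (c) => (b): for P = eta formula (c) reads Kt X = K X + S (rho X), because
  alpha is homogeneous of degree 0. *)

Set Implicit Arguments.
Unset Strict Implicit.
Unset Printing Implicit Defensive.

Import Order.TTheory GRing.Theory Num.Theory.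
Import numFieldNormedType.Exports.

Local Open Scope classical_set_scope.
Local Open Scope ring_scope.

(** * Calculus of functions of class C^k *)

Section Calculus.
Context {R : realType}.

Lemma near_eq_differentiable (E : normedModType R) (f g : E -> R) (x : E) :
  (\near x, f x = g x) -> differentiable f x -> differentiable g x.
Proof.
move=> fg df; have [dc dl] := (diff_locallyP _ _).1 df.
have gl : g \o shift x = cst (g x) + 'd f x +o_ (nbhs (0 : E)) id.
  apply/eqaddoP => _/posnumP[e].
  have /eqaddoP /(_ e%:num) /(_ [gt0 of e%:num]) := dl.
  have fgx := nbhs_singleton fg.
  apply: filter_app.
  have : \forall y \near (0 : E), f (y + x) = g (y + x).
    by move: fg; rewrite (near_shift 0 x); apply: filterS => y /=; rewrite subr0.
  apply: filterS => y /= fgy.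
  by rewrite -![(_ + _ : _ -> _) _]/(_ + _) -![(- _ : _ -> _) _]/(- _) /=
     -![(_ + _ : _ -> _) _]/(_ + _) /= -fgy -fgx.
apply/diff_locallyP; have -> : 'd g x = 'd f x :> (E -> R) by exact: diff_unique.
by split.
Unshelve. all: by end_near. Qed.

Section OneSpace.
Context {E : normedModType R}.
Implicit Types (U V : set E) (f g : E -> R).

Lemma open_near U (P : E -> Prop) x : open U -> U x -> (forall y, U y -> P y) ->
  \near x, P x.
Proof. by move=> oU Ux UP; apply: filterS UP _; exact: open_nbhs_nbhs. Qed.

Lemma Ck_ext k U f g : open U -> (forall x, U x -> f x = g x) ->
  Ck k U f -> Ck k U g.
Proof.
elim: k f g => [|k IH] f g oU fg /=.
  move=> fc x Ux; rewrite /prop_for /continuous_at -(fg _ Ux).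
  apply: cvg_trans (fc _ Ux).
  by apply: near_eq_cvg; exact: (open_near oU Ux).
move=> [df dk]; split=> [x Ux|v].
  by apply: near_eq_differentiable (df _ Ux); exact: (open_near oU Ux).
apply: IH (dk v) => // x Ux.
by apply: near_eq_derive; exact: (open_near oU Ux).
Qed.

Lemma Ck_sub k U V f : V `<=` U -> Ck k U f -> Ck k V f.
Proof.
move=> VU; elim: k f => [|k IH] f /=; first by move=> fc x /VU /fc.
by move=> [df dk]; split=> [x /VU /df //|v]; exact: IH.
Qed.

Lemma CkS k U f : Ck k.+1 U f -> Ck k U f.
Proof.
elim: k f => [|k IH] f [df dk].
  by move=> x Ux; apply: differentiable_continuous; exact: df.
by split=> // v; apply: IH; exact: dk.
Qed.

Lemma Ck_cst k U a : Ck k U (cst a).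
Proof.
elim: k a => [|k IH] a; first by move=> x _; exact: cst_continuous.
split=> [x _ //|v].
rewrite (_ : 'D_v _ = cst 0) //.
by apply/funext => x; rewrite derive_cst.
Qed.

Lemma CkD k U f g : open U -> Ck k U f -> Ck k U g -> Ck k U (f + g).
Proof.
move=> oU; elim: k f g => [|k IH] f g.
  by move=> fc gc x Ux; apply: continuousD; [exact: fc|exact: gc].
move=> [df fk] [dg gk]; split=> [x Ux|v].
  by apply: differentiableD; [exact: df|exact: dg].
apply: Ck_ext (IH _ _ (fk v) (gk v)) => // x Ux.
by rewrite deriveD //; apply: diff_derivable; [exact: df|exact: dg].
Qed.

Lemma CkM k U f g : open U -> Ck k U f -> Ck k U g -> Ck k U (f * g).
Proof.
move=> oU; elim: k f g => [|k IH] f g.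
  by move=> fc gc x Ux; apply: continuousM; [exact: fc|exact: gc].
move=> fk gk; have [df fk'] := fk; have [dg gk'] := gk; split=> [x Ux|v].
  by apply: differentiableM; [exact: df|exact: dg].
apply: (@Ck_ext _ _ (f * 'D_v g + g * 'D_v f)) => //.
  move=> x Ux.
  by rewrite deriveM //; apply: diff_derivable; [exact: df|exact: dg].
by apply: CkD oU (IH _ _ (CkS fk) (gk' v)) (IH _ _ (CkS gk) (fk' v)).
Qed.

Lemma Ck_sum k U (I : finType) (f : I -> E -> R) : open U ->
  (forall i, Ck k U (f i)) -> Ck k U (\sum_i f i).
Proof.
move=> oU fk; elim/big_ind : _ => //; first exact: Ck_cst.
by move=> *; exact: CkD.
Qed.

Lemma Coo_ext U f g : open U -> (forall x, U x -> f x = g x) ->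
  Coo U f -> Coo U g.
Proof. by move=> oU fg ff k; apply: Ck_ext (ff k). Qed.

Lemma Coo_sub U V f : V `<=` U -> Coo U f -> Coo V f.
Proof. by move=> VU ff k; apply: Ck_sub (ff k). Qed.

Lemma Coo_cst U a : Coo U (cst a).
Proof. by move=> k; exact: Ck_cst. Qed.

Lemma CooD U f g : open U -> Coo U f -> Coo U g -> Coo U (f + g).
Proof. by move=> oU ff gg k; exact: CkD. Qed.

Lemma CooM U f g : open U -> Coo U f -> Coo U g -> Coo U (f * g).
Proof. by move=> oU ff gg k; exact: CkM. Qed.

Lemma Coo_sum U (I : finType) (f : I -> E -> R) : open U ->
  (forall i, Coo U (f i)) -> Coo U (\sum_i f i).
Proof. by move=> oU ff k; apply: Ck_sum => // i; exact: ff. Qed.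

Lemma Coo_derive U f v : Coo U f -> Coo U ('D_v f).
Proof. by move=> ff k; have [_] := ff k.+1; exact. Qed.

Lemma Coo_diff U f x : Coo U f -> U x -> differentiable f x.
Proof. by move=> ff Ux; have [+ _] := ff 1%N; exact. Qed.

Lemma Coo_linear U (f : {linear E -> R}) : continuous f -> Coo U f.
Proof.
move=> fc [|k]; first by move=> x _; exact: fc.
split=> [x _|v]; first exact: linear_differentiable.
rewrite (_ : 'D_v _ = cst (f v)); first exact: Ck_cst.
apply/funext => x; rewrite deriveE ?diff_lin //; exact: linear_differentiable.
Qed.

End OneSpace.
End Calculus.

(** Linear coordinates on a model space, in a form that covers both those of M
and those of its tangent bundle. *)
Record frame (R : realType) (E : normedModType R) (I : finType) := Frame {
  fvec : I -> E ;
  fcoord : I -> {linear E -> R} ;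
  fcoord_cont : forall i, continuous (fcoord i) ;
  fcoord_sum : forall x, x = \sum_i fcoord i x *: fvec i }.

Section Composition.
Context {R : realType} {E E' : normedModType R} {I : finType} (F : frame E I).

Lemma derive_frame (f : E -> R) x v : differentiable f x ->
  'D_v f x = \sum_i fcoord F i v * 'D_(fvec F i) f x.
Proof.
move=> df; rewrite deriveE // {1}(fcoord_sum F v) linear_sum.
by apply: eq_bigr => i _; rewrite linearZ deriveE.
Qed.

Section Phi.
Variable phi : E' -> E.
Implicit Types (V : set E').

Lemma differentiable_frame y : (forall i, differentiable (fcoord F i \o phi) y) ->
  differentiable phi y.
Proof.
move=> dp.
rewrite (_ : phi = \sum_i (fun z => (fcoord F i \o phi) z *: fvec F i)).
  elim/big_ind : _ => //; last by move=> i _; exact: differentiableZl.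
  by move=> f g; exact: differentiableD.
by apply/funext => z; rewrite fct_sumE {1}(fcoord_sum F (phi z)).
Qed.

Lemma derive_comp_frame (f : E -> R) y v :
  (forall i, differentiable (fcoord F i \o phi) y) -> differentiable f (phi y) ->
  'D_v (f \o phi) y =
    \sum_i 'D_v (fcoord F i \o phi) y * 'D_(fvec F i) f (phi y).
Proof.
move=> dp df; have dphi := differentiable_frame dp.
rewrite deriveE; last exact: differentiable_comp.
rewrite diff_comp //= -deriveE // (derive_frame _ df).
apply: eq_bigr => i _; congr (_ * _).
have dc : differentiable (fcoord F i) (phi y).
  by apply: linear_differentiable; exact: fcoord_cont.
by rewrite deriveE // (diff_comp dphi dc) /= diff_lin //; exact: fcoord_cont.
Qed.

(** The derivative of f o phi is a sum of products of functions of the same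
kind, one class lower. *)
Lemma Ck_comp k V U (f : E -> R) : open V -> open U ->
  (forall y, V y -> U (phi y)) ->
  (forall i, Ck k V (fcoord F i \o phi)) -> Ck k U f -> Ck k V (f \o phi).
Proof.
move=> oV oU VU; elim: k f => [|k IH] f pk fk.
  move=> y Vy; apply: continuous_comp; last by apply: fk; exact: VU.
  rewrite (_ : phi = \sum_i (fun z => (fcoord F i \o phi) z *: fvec F i)).
    elim/big_ind : _ => //.
    - exact: cst_continuous.
    - by move=> a b ca cb; exact: (continuousD ca cb).
    - move=> i _; apply: (@continuousZr_tmp _ _ _ (fcoord F i \o phi)).
      exact: pk.
  by apply/funext => z; rewrite fct_sumE {1}(fcoord_sum F (phi z)).
have [df fk'] := fk.
have dp y : V y -> forall i, differentiable (fcoord F i \o phi) y.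
  by move=> Vy i; have [+ _] := pk i; exact.
split=> [y Vy|v].
  apply: differentiable_comp; last by apply: df; exact: VU.
  exact/differentiable_frame/dp.
apply: (@Ck_ext _ _ _ _
  (\sum_i 'D_v (fcoord F i \o phi) * ('D_(fvec F i) f \o phi))) => //.
  move=> y Vy; rewrite derive_comp_frame ?fct_sumE //; first exact: dp.
  by apply: df; exact: VU.
apply: Ck_sum => // i; apply: CkM => //; first by have [_] := pk i; exact.
by apply: (IH _ _ (fk' _)) => j; apply: CkS; exact: pk.
Qed.

Lemma Coo_comp V U (f : E -> R) : open V -> open U ->
  (forall y, V y -> U (phi y)) ->
  (forall i, Coo V (fcoord F i \o phi)) -> Coo U f -> Coo V (f \o phi).
Proof.
by move=> oV oU VU pk fk k; apply: (Ck_comp oV oU VU) => // i; exact: pk.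
Qed.

End Phi.
End Composition.

(** * Symmetry of second derivatives *)

Section Schwarz.
Context {R : realType} {E : normedModType R}.
Implicit Types (U : set E) (f : E -> R) (v w p a : E).

Lemma is_derive_line f v p (s : R) : derivable f (s *: v + p) v ->
  is_derive s 1 (fun t : R => f (t *: v + p)) ('D_v f (s *: v + p)).
Proof.
have eqg : (fun h : R => h^-1 *: (((fun t : R => f (t *: v + p)) \o shift s)
      (h *: 1) - f (s *: v + p))) =
    (fun h => h^-1 *: ((f \o shift (s *: v + p)) (h *: v) - f (s *: v + p))).
  apply/funext => h /=; congr (_ *: (f _ - _)).
  by rewrite [h *: 1]mulr1 scalerDl addrA.
move=> df; split; first by rewrite /derivable eqg.
by rewrite /derive eqg.
Qed.

Lemma MVT_derivable (g dg : R -> R) (h : R) : 0 < h ->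
  (forall s, 0 <= s <= h -> is_derive s 1 g (dg s)) ->
  exists2 c, 0 <= c <= h & g h - g 0 = dg c * h.
Proof.
move=> h0 gd; have [||c cI ->] := @MVT R g dg 0 h h0.
- by move=> s /[!in_itv] /= /andP[s0 sh]; apply: gd; rewrite !ltW.
- apply: continuous_in_subspaceT => s; rewrite inE /= in_itv /= => sh.
  apply: differentiable_continuous; apply/derivable1_diffP.
  exact: @ex_derive _ _ _ _ _ _ _ (gd s sh).
by exists c; [move: cI; rewrite in_itv /= => /andP[? ?]; rewrite !ltW|rewrite subr0].
Qed.

(** Applying the mean value theorem first along v and then along w turns the
second difference of f into a value of its mixed derivative; the other order
of application gives the other mixed derivative of the same quantity. *)
Lemma second_difference U f a v w (h : R) : 0 < h -> Ck 2 U f ->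
  (forall s t, 0 <= s <= h -> 0 <= t <= h -> U (s *: v + (t *: w + a))) ->
  exists c d, [/\ 0 <= c <= h, 0 <= d <= h &
    f (h *: v + (h *: w + a)) - f (h *: v + a) - (f (h *: w + a) - f a) =
    'D_w ('D_v f) (d *: w + (c *: v + a)) * h * h].
Proof.
move=> h0 [df /(_ v) [ddf _]] UU.
have hh : 0 <= h <= h by apply/andP; split; [exact: ltW|].
have h00 : 0 <= (0 : R) <= h by rewrite lexx ltW.
pose phi (s : R) := f (s *: v + (h *: w + a)) - f (s *: v + a).
have dphi s : 0 <= s <= h -> is_derive s 1 phi
    ('D_v f (s *: v + (h *: w + a)) - 'D_v f (s *: v + a)).
  move=> s1; apply: is_deriveB; apply: is_derive_line; apply: diff_derivable;
    apply: df; first exact: UU.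
  by have := UU s 0 s1 h00; rewrite scale0r add0r.
have [c c1 phiE] := MVT_derivable h0 dphi.
have [t t1|d d1 psiE] := @MVT_derivable (fun t => 'D_v f (t *: w + (c *: v + a)))
    (fun t => 'D_w ('D_v f) (t *: w + (c *: v + a))) h h0.
  apply: is_derive_line; apply: diff_derivable; apply: ddf.
  by rewrite addrCA; exact: UU.
exists c, d; split=> //.
move: phiE psiE; rewrite /phi !scale0r !add0r => -> <-.
by rewrite (addrCA (c *: v)).
Qed.

Lemma small_parallelogram a v w (r : R) : 0 < r ->
  exists2 h, 0 < h & forall s t, 0 <= s <= h -> 0 <= t <= h ->
    ball a r (s *: v + (t *: w + a)).
Proof.
move=> r0; pose h := r / (`|v| + `|w| + 1).
have N0 : 0 < `|v| + `|w| + 1 by rewrite ltr_wpDl // addr_ge0.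
have h0 : 0 < h by rewrite divr_gt0.
exists h => // s t.
move=> /andP[s0 sh] /andP[t0 th]; rewrite -ball_normE /ball_ /=.
rewrite addrA [_ + a]addrC opprD addNKr normrN.
apply: le_lt_trans (ler_normD _ _) _; rewrite !normrZ !ger0_norm //.
apply: (@le_lt_trans _ _ (h * `|v| + h * `|w|)).
  by apply: lerD; apply: ler_wpM2r.
rewrite -mulrDr -[ltRHS](divfK (lt0r_neq0 N0)) -/h.
by rewrite ltr_pM2l // ltrDl.
Qed.

Lemma mixed_difference (x y z t b c h : R) : h != 0 ->
  x - y - (z - t) = b * h * h -> x - z - (y - t) = c * h * h -> b = c.
Proof.
move=> h0 xb xc; apply: (mulIf h0); apply: (mulIf h0); rewrite -xb -xc.
by ring.
Qed.

(** Both mixed derivatives approximate the same second difference over small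
parallelograms, and they are continuous. *)
Lemma Schwarz U f a v w : open U -> U a -> Ck 2 U f ->
  'D_v ('D_w f) a = 'D_w ('D_v f) a.
Proof.
move=> oU Ua f2.
have [_ fvw] := f2.
have cA : {for a, continuous ('D_w ('D_v f))} by have [_ /(_ w) /(_ a Ua)] := fvw v.
have cB : {for a, continuous ('D_v ('D_w f))} by have [_ /(_ v) /(_ a Ua)] := fvw w.
apply/eqP; rewrite -subr_eq0 -normr_le0; apply/ler_addgt0Pl => e e0.
rewrite addr0.
have e2 : 0 < e / 2 by rewrite divr_gt0.
have nU : nbhs a U by exact: open_nbhs_nbhs.
have nA : \forall x \near a, `|'D_w ('D_v f) a - 'D_w ('D_v f) x| < e / 2.
  by move/cvgrPdist_lt : cA; apply.
have nB : \forall x \near a, `|'D_v ('D_w f) a - 'D_v ('D_w f) x| < e / 2.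
  by move/cvgrPdist_lt : cB; apply.
have [r /= r0 rW] : nbhs_ball a (U `&`
    ([set x | `|'D_w ('D_v f) a - 'D_w ('D_v f) x| < e / 2] `&`
     [set x | `|'D_v ('D_w f) a - 'D_v ('D_w f) x| < e / 2])).
  by apply/nbhs_ballP; apply: filterI nU (filterI nA nB).
have [h h0 hb] : exists2 h, 0 < h & forall s t, 0 <= s <= h -> 0 <= t <= h ->
    ball a r (s *: v + (t *: w + a)).
  exact: small_parallelogram.
have [|c [d [c1 d1 E1]]] := @second_difference U f a v w h h0 f2.
  by move=> s t s1 t1; have [] := rW _ (hb s t s1 t1).
have [|d' [c' [d1' c1' E2]]] := @second_difference U f a w v h h0 f2.
  by move=> s t s1 t1; rewrite addrCA; have [] := rW _ (hb t s t1 s1).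
have EE : 'D_w ('D_v f) (d *: w + (c *: v + a)) =
    'D_v ('D_w f) (c' *: v + (d' *: w + a)).
  rewrite (addrCA (h *: w) (h *: v) a) in E2.
  exact: mixed_difference (lt0r_neq0 h0) E1 E2.
have [_ [dA _]] := rW _ (hb c d c1 d1).
have [_ [_ dB]] := rW _ (hb c' d' c1' d1').
rewrite /= addrCA EE in dA.
rewrite -(subrKA ('D_v ('D_w f) (c' *: v + (d' *: w + a)))).
apply: le_trans (ler_normD _ _) _; rewrite [leRHS]splitr.
apply: lerD.
  exact: (ltW dB).
by rewrite distrC; exact: (ltW dA).
Qed.

End Schwarz.

(** * Manifolds given by an atlas *)

Lemma lrep_inj (R : realType) (E : normedModType R) (N : Type)
    (c : chart E N) (f : N -> R) q :
  {in cdom c &, injective c} -> cdom c q -> lrep c f (c q) = f q.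
Proof.
move=> inj cq; apply: xget_unique; first by exists q.
by move=> _ [q' [cq' /= e] <-]; rewrite (inj _ _ _ _ e) // inE.
Qed.

(** What the differential calculus on N uses of an atlas.  No topology on N
occurs: the second and third clauses let open sets be transported between
charts, so the same calculus serves the slit tangent bundle. *)
Definition good_atlas (R : realType) (E : normedModType R) (I : finType)
    (F : frame E I) (N : Type) (A : set (chart E N)) :=
  [/\ forall p, exists2 c, A c & cdom c p,
      forall c, A c -> {in cdom c &, injective c},
      forall c d, A c -> A d -> open (c @` (cdom c `&` cdom d)) &
      forall c d, A c -> A d -> forall i,
        Coo (c @` (cdom c `&` cdom d)) (lrep c (fcoord F i \o d))].

Section Manifold.
Context {R : realType} {E : normedModType R} {I : finType} {F : frame E I}.
Context {N : Type} {A : set (chart E N)} (hA : good_atlas F A).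
Implicit Types (c d : chart E N) (p q : N) (f g : N -> R) (U V : set E).

Lemma atlas_cover p : exists2 c, A c & cdom c p.
Proof. by case: hA. Qed.

Lemma lrepE c f q : A c -> cdom c q -> lrep c f (c q) = f q.
Proof. by case: hA => _ inj _ _ Ac; apply: lrep_inj; exact: inj. Qed.

Lemma chart_open c d : A c -> A d -> open (c @` (cdom c `&` cdom d)).
Proof. by case: hA => _ _ op _; exact: op. Qed.

Lemma chart_dom_open c : A c -> open (c @` cdom c).
Proof. by move=> Ac; have := chart_open Ac Ac; rewrite setIid. Qed.

(** The change of coordinates c o d^-1, assembled from its components. *)
Definition transition d c (y : E) : E :=
  \sum_i lrep d (fcoord F i \o c) y *: fvec F i.

Lemma transitionE d c q : A d -> cdom d q -> transition d c (d q) = c q.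
Proof.
move=> Ad dq; rewrite [RHS](fcoord_sum F); apply: eq_bigr => i _.
by rewrite lrepE.
Qed.

Section Change.
Variables (d c : chart E N).
Hypotheses (Ad : A d) (Ac : A c).
Let W := d @` (cdom d `&` cdom c).

Lemma lrep_transition f y : W y -> lrep d f y = lrep c f (transition d c y).
Proof. by move=> [q [dq cq] <-]; rewrite transitionE // !lrepE. Qed.

Lemma fcoord_transition i y : W y ->
  fcoord F i (transition d c y) = lrep d (fcoord F i \o c) y.
Proof. by move=> [q [dq cq] <-]; rewrite transitionE // lrepE. Qed.

Lemma Coo_transition i : Coo W (fcoord F i \o transition d c).
Proof.
have oW : open W by exact: chart_open.
apply: Coo_ext oW _ (_ : Coo W (lrep d (fcoord F i \o c))).
  by move=> y Wy /=; rewrite fcoord_transition.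
by case: hA => _ _ _; apply.
Qed.

Lemma open_transition U : open U -> open (W `&` transition d c @^-1` U).
Proof.
move=> oU; rewrite openE => y [Wy Uy]; apply: filterI.
  by apply: open_nbhs_nbhs; split=> //; exact: chart_open.
have /differentiable_continuous cphi : differentiable (transition d c) y.
  by apply: (differentiable_frame (F := F)) => i; apply: Coo_diff Wy; exact: Coo_transition.
by apply: cphi; exact: open_nbhs_nbhs.
Qed.

End Change.

(** N carries no topology: neighbourhoods are read in charts. *)
Definition near_at p (Q : N -> Prop) := exists c, [/\ A c, cdom c p &
  exists U, [/\ open U, U (c p), U `<=` c @` cdom c &
    forall q, cdom c q -> U (c q) -> Q q]].

Lemma near_in d p Q : A d -> cdom d p -> near_at p Q ->
  exists U, [/\ open U, U (d p), U `<=` d @` cdom d &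
    forall q, cdom d q -> U (d q) -> Q q].
Proof.
move=> Ad dp [c [Ac cp [U [oU Up Uc UQ]]]].
exists (d @` (cdom d `&` cdom c) `&` transition d c @^-1` U); split.
- exact: open_transition.
- by split; [exists p|rewrite /= transitionE].
- by move=> y [[q [dq cq] <-] _]; exists q.
- move=> q dq [[q' [dq' cq'] e]]; rewrite /= transitionE //.
  have <- : q' = q by case: hA => _ inj _ _; apply: (inj _ Ad) e; rewrite inE.
  exact: UQ.
Qed.

Lemma smooth_in d p f : A d -> cdom d p -> smooth_at A p f ->
  exists U, [/\ open U, U (d p), U `<=` d @` cdom d & Coo U (lrep d f)].
Proof.
move=> Ad dp [c [Ac cp [U [oU Up Uc Uf]]]].
have oV := open_transition Ad Ac oU.
exists (d @` (cdom d `&` cdom c) `&` transition d c @^-1` U); split=> //.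
- by split; [exists p|rewrite /= transitionE].
- by move=> y [[q [dq cq] <-] _]; exists q.
apply: (Coo_ext oV _ (_ : Coo _ (lrep c f \o transition d c))).
  by move=> y [Wy _] /=; rewrite (lrep_transition Ad Ac).
apply: (Coo_comp (F := F) oV oU _ _ Uf) => [y []//|i].
by apply: Coo_sub (Coo_transition Ad Ac i); exact: subIsetl.
Qed.

Lemma near_at_self p Q : near_at p Q -> Q p.
Proof. by move=> [c [Ac cp [U [_ Up _]]]]; apply. Qed.

Lemma near_at_sub p (Q Q' : N -> Prop) : (forall q, Q q -> Q' q) ->
  near_at p Q -> near_at p Q'.
Proof.
move=> QQ [c [Ac cp [U [oU Up Uc UQ]]]].
exists c; split=> //; exists U; split=> // q cq Uq; exact/QQ/UQ.
Qed.

Lemma near_atI p (Q Q' : N -> Prop) : near_at p Q -> near_at p Q' ->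
  near_at p (fun q => Q q /\ Q' q).
Proof.
move=> nQ nQ'; have [c Ac cp] := atlas_cover p.
have [U [oU Up Uc UQ]] := near_in Ac cp nQ.
have [V [oV Vp _ VQ]] := near_in Ac cp nQ'.
exists c; split=> //; exists (U `&` V); split=> //.
- exact: openI.
- by move=> y [/Uc].
- by move=> q cq [Uq Vq]; split; [exact: UQ|exact: VQ].
Qed.

Lemma near_atT p (Q : N -> Prop) : (forall q, Q q) -> near_at p Q.
Proof.
move=> QQ; have [c Ac cp] := atlas_cover p.
exists c; split=> //; exists (c @` cdom c).
by split; [exact: chart_dom_open|exists p|exact: subset_refl|move=> q _ _; exact: QQ].
Qed.

Lemma near_at_dom c p : A c -> cdom c p -> near_at p (cdom c).
Proof.
move=> Ac cp; exists c; split=> //; exists (c @` cdom c).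
by split; [exact: chart_dom_open|exists p|exact: subset_refl|].
Qed.

Lemma smooth_near p f : smooth_at A p f -> near_at p (fun q => smooth_at A q f).
Proof.
move=> [c [Ac cp [U [oU Up Uc Uf]]]].
exists c; split=> //; exists U; split=> // q cq Uq.
by exists c; split=> //; exists U.
Qed.

(** A local representation is 0 outside its chart, so identities between local
representations hold only inside it; this lemma accepts any h that has the
right values near p. *)
Lemma smooth_chart c p f (h : E -> R) : A c -> cdom c p -> (forall U, open U ->
    U (c p) -> U `<=` c @` cdom c -> exists V, [/\ open V, V (c p), V `<=` U &
    Coo V h]) ->
  near_at p (fun q => cdom c q -> f q = h (c q)) -> smooth_at A p f.
Proof.
move=> Ac cp hh /(near_in Ac cp)[U [oU Up Uc fh]].
have [V [oV Vp VU Vh]] := hh _ oU Up Uc.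
exists c; split=> //; exists V; split=> //; first exact: subset_trans Uc.
apply: Coo_ext oV _ Vh => y Vy.
by have [q cq e] := Uc _ (VU _ Vy); rewrite -e lrepE // fh // e; exact: VU.
Qed.

Lemma smooth_ext p f g : near_at p (fun q => f q = g q) ->
  smooth_at A p f -> smooth_at A p g.
Proof.
move=> fg sf; have [c Ac cp] := atlas_cover p.
have [V [oV Vp Vc Vf]] := smooth_in Ac cp sf.
apply: (smooth_chart (h := lrep c f) Ac cp).
  move=> U oU Up Uc; exists (U `&` V); split=> //; first exact: openI.
  exact: Coo_sub Vf.
by apply: near_at_sub fg => q <- cq; rewrite lrepE.
Qed.

Lemma smooth_cst p (a : R) : smooth_at A p (cst a).
Proof.
have [c Ac cp] := atlas_cover p.
apply: (smooth_chart (h := cst a) Ac cp); last exact: near_atT.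
by move=> U oU Up Uc; exists U; split=> //; exact: Coo_cst.
Qed.

Lemma smoothD p f g : smooth_at A p f -> smooth_at A p g -> smooth_at A p (f + g).
Proof.
move=> sf sg; have [c Ac cp] := atlas_cover p.
have [V [oV Vp Vc Vf]] := smooth_in Ac cp sf.
have [W [oW Wp Wc Wg]] := smooth_in Ac cp sg.
apply: (smooth_chart (h := lrep c f + lrep c g) Ac cp).
  have oVW : open (V `&` W) by exact: openI.
  move=> U oU Up Uc; exists (U `&` (V `&` W)); split=> //; first exact: openI.
  by apply: Coo_sub (CooD oVW (Coo_sub _ Vf) (Coo_sub _ Wg)) => [y []|y []|y []].
apply: near_atT => q cq.
by rewrite -![(_ + _ : _ -> _) _]/(_ + _) !lrepE.
Qed.

Lemma smoothM p f g : smooth_at A p f -> smooth_at A p g -> smooth_at A p (f * g).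
Proof.
move=> sf sg; have [c Ac cp] := atlas_cover p.
have [V [oV Vp Vc Vf]] := smooth_in Ac cp sf.
have [W [oW Wp Wc Wg]] := smooth_in Ac cp sg.
apply: (smooth_chart (h := lrep c f * lrep c g) Ac cp).
  have oVW : open (V `&` W) by exact: openI.
  move=> U oU Up Uc; exists (U `&` (V `&` W)); split=> //; first exact: openI.
  by apply: Coo_sub (CooM oVW (Coo_sub _ Vf) (Coo_sub _ Wg)) => [y []|y []|y []].
apply: near_atT => q cq.
by rewrite -![(_ * _ : _ -> _) _]/(_ * _) !lrepE.
Qed.

Lemma smoothN p f : smooth_at A p f -> smooth_at A p (- f).
Proof.
move=> sf; have -> : - f = cst (-1) * f.
  by apply/funext => q; rewrite -[RHS]/(-1 * f q) mulN1r.
by apply: smoothM => //; exact: smooth_cst.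
Qed.

Lemma smooth_sum p (J : finType) (f : J -> N -> R) :
  (forall j, smooth_at A p (f j)) -> smooth_at A p (\sum_j f j).
Proof.
move=> sf; elim/big_ind : _ => //; first exact: smooth_cst.
by move=> *; exact: smoothD.
Qed.

Lemma smooth_coord c i p : A c -> cdom c p -> smooth_at A p (fcoord F i \o c).
Proof.
move=> Ac cp; exists c; split=> //; exists (c @` cdom c).
split; [exact: chart_dom_open|by exists p|exact: subset_refl|].
by case: hA => _ _ _ /(_ c c Ac Ac i); rewrite setIid.
Qed.

Definition cderiv c (v : E) f : N -> R := fun q => 'D_v (lrep c f) (c q).

Lemma smooth_cderiv c v p f : A c -> cdom c p -> smooth_at A p f ->
  smooth_at A p (cderiv c v f).
Proof.
move=> Ac cp sf; have [V [oV Vp Vc Vf]] := smooth_in Ac cp sf.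
apply: (smooth_chart (h := 'D_v (lrep c f)) Ac cp); last exact: near_atT.
move=> U oU Up Uc; exists (U `&` V); split=> //; first exact: openI.
exact: (Coo_sub (@subIsetr _ U V) (Coo_derive v Vf)).
Qed.

Lemma cderiv_cderiv c v w p f : A c -> cdom c p -> smooth_at A p f ->
  cderiv c v (cderiv c w f) p = 'D_v ('D_w (lrep c f)) (c p).
Proof.
move=> Ac cp sf; rewrite /cderiv; apply: near_eq_derive.
have oc := chart_dom_open Ac.
apply: (open_near oc); first by exists p.
by move=> _ [q cq <-]; rewrite lrepE.
Qed.

Lemma cderivC c v w p f : A c -> cdom c p -> smooth_at A p f ->
  cderiv c v (cderiv c w f) p = cderiv c w (cderiv c v f) p.
Proof.
move=> Ac cp sf.
rewrite (cderiv_cderiv v w Ac cp sf) (cderiv_cderiv w v Ac cp sf).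
have [V [oV Vp Vc Vf]] := smooth_in Ac cp sf.
exact: (Schwarz v w oV Vp (Vf 2%N)).
Qed.

Lemma near_lrep c p f g : A c -> cdom c p -> near_at p (fun q => f q = g q) ->
  \forall y \near c p, lrep c f y = lrep c g y.
Proof.
move=> Ac cp /(near_in Ac cp)[U [oU Up Uc fg]].
apply: (open_near oU) => // y Uy; have [q cq e] := Uc _ Uy.
by rewrite -e !lrepE // fg // e.
Qed.

Lemma lrep_diff c p f : A c -> cdom c p -> smooth_at A p f ->
  differentiable (lrep c f) (c p).
Proof.
move=> Ac cp sf; have [V [oV Vp Vc Vf]] := smooth_in Ac cp sf.
exact: Coo_diff Vp.
Qed.

Lemma near_lrep2 c p f g (op : R -> R -> R) : A c -> cdom c p ->
  \forall y \near c p, lrep c (fun q => op (f q) (g q)) y =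
    op (lrep c f y) (lrep c g y).
Proof.
move=> Ac cp; apply: (open_near (chart_dom_open Ac)); first by exists p.
by move=> _ [q cq <-]; rewrite !lrepE.
Qed.

Lemma cderiv_coord c v i p : A c -> cdom c p ->
  cderiv c v (fcoord F i \o c) p = fcoord F i v.
Proof.
move=> Ac cp; rewrite /cderiv (near_eq_derive (g := fcoord F i)); last first.
  apply: (open_near (chart_dom_open Ac)); first by exists p.
  by move=> _ [q cq <-]; rewrite lrepE.
rewrite deriveE; first by rewrite diff_lin //; exact: fcoord_cont.
by apply: linear_differentiable; exact: fcoord_cont.
Qed.

(** * Tangent vectors *)

Lemma on_smoothE p (X : (N -> R) -> R) f : smooth_at A p f ->
  on_smooth A p X f = X f.
Proof. by move=> sf; rewrite /on_smooth asboolT. Qed.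

Lemma tangent_off p (X : (N -> R) -> R) f : tangent A p X ->
  ~ smooth_at A p f -> X f = 0.
Proof. by move=> [c [_ _ [v ->]]] sf; rewrite /on_smooth asboolF. Qed.

Lemma tangent_ext p (X Y : (N -> R) -> R) : tangent A p X -> tangent A p Y ->
  (forall f, smooth_at A p f -> X f = Y f) -> X = Y.
Proof.
move=> tX tY XY; apply/funext => f.
have [/XY//|sf] := pselect (smooth_at A p f).
by rewrite (tangent_off tX sf) (tangent_off tY sf).
Qed.

Section TangentVector.
Variables (p : N) (X : (N -> R) -> R).
Hypothesis tX : tangent A p X.

Lemma tangentD f g : smooth_at A p f -> smooth_at A p g ->
  X (f + g) = X f + X g.
Proof.
case: tX => c [Ac cp [v ->]] sf sg; rewrite !on_smoothE //; last exact: smoothD.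
rewrite (near_eq_derive _ (near_lrep2 f g +%R Ac cp)) deriveD //.
  by apply: diff_derivable; exact: lrep_diff.
by apply: diff_derivable; exact: lrep_diff.
Qed.

Lemma tangentM f g : smooth_at A p f -> smooth_at A p g ->
  X (f * g) = f p * X g + g p * X f.
Proof.
case: tX => c [Ac cp [v ->]] sf sg; rewrite !on_smoothE //; last exact: smoothM.
rewrite (near_eq_derive _ (near_lrep2 f g *%R Ac cp)) deriveM ?lrepE //.
  by apply: diff_derivable; exact: lrep_diff.
by apply: diff_derivable; exact: lrep_diff.
Qed.

Lemma tangent_near f g : near_at p (fun q => f q = g q) -> X f = X g.
Proof.
move=> fg; have [sf|sf] := pselect (smooth_at A p f); last first.
  rewrite !(tangent_off tX) // => sg; apply: sf; apply: smooth_ext sg.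
  by apply: near_at_sub fg => q ->.
have sg := smooth_ext fg sf.
case: tX => c [Ac cp [v ->]]; rewrite !on_smoothE //.
by apply: near_eq_derive; exact: near_lrep.
Qed.

Lemma tangent_cst (a : R) : X (cst a) = 0.
Proof.
case: tX => c [Ac cp [v ->]]; rewrite !on_smoothE //; last exact: smooth_cst.
rewrite (near_eq_derive (g := cst a)) ?derive_cst //.
apply: (open_near (chart_dom_open Ac)); first by exists p.
by move=> _ [q cq <-]; rewrite lrepE.
Qed.

Lemma tangent_sum (J : finType) (f : J -> N -> R) :
  (forall j, smooth_at A p (f j)) -> X (\sum_j f j) = \sum_j X (f j).
Proof.
move=> sf; pose Q (g : N -> R) (x : R) := smooth_at A p g /\ X g = x.
suff [] : Q (\sum_j f j) (\sum_j X (f j)) by [].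
apply: (big_ind2 Q); first by split; [exact: smooth_cst|exact: tangent_cst].
  by move=> g1 x1 g2 x2 [s1 <-] [s2 <-]; split; [exact: smoothD|rewrite tangentD].
by move=> j _; split.
Qed.

(** By the chain rule, the chart that witnesses tangency can be replaced by any
other one. *)
Lemma tangentE c f : A c -> cdom c p -> smooth_at A p f ->
  X f = \sum_i X (fcoord F i \o c) * cderiv c (fvec F i) f p.
Proof.
case: tX => d [Ad dp [v ->]] Ac cp sf; rewrite on_smoothE //.
have oW := chart_open Ad Ac.
have Wp : (d @` (cdom d `&` cdom c)) (d p) by exists p.
rewrite (near_eq_derive (g := lrep c f \o transition d c)); last first.
  by apply: (open_near oW Wp) => y Wy /=; rewrite (lrep_transition Ad Ac).
rewrite (derive_comp_frame (F := F)); last 2 first.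
- by move=> i; apply: Coo_diff Wp; exact: Coo_transition.
- by rewrite transitionE //; exact: lrep_diff.
apply: eq_bigr => i _; rewrite transitionE // on_smoothE; last exact: smooth_coord.
congr (_ * _); apply: near_eq_derive.
by apply: (open_near oW Wp) => y Wy /=; rewrite (fcoord_transition Ad i Wy).
Qed.

End TangentVector.

Lemma tangent_coord_ext c p (X Y : (N -> R) -> R) : A c -> cdom c p ->
  tangent A p X -> tangent A p Y ->
  (forall i, X (fcoord F i \o c) = Y (fcoord F i \o c)) -> X = Y.
Proof.
move=> Ac cp tX tY XY; apply: (tangent_ext tX tY) => f sf.
by rewrite (tangentE tX Ac cp sf) (tangentE tY Ac cp sf); apply: eq_bigr => i _; rewrite XY.
Qed.

Lemma tangent_mk c p (X : (N -> R) -> R) (a : I -> R) : A c -> cdom c p ->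
  (forall f, ~ smooth_at A p f -> X f = 0) ->
  (forall f, smooth_at A p f -> X f = \sum_i a i * cderiv c (fvec F i) f p) ->
  tangent A p X.
Proof.
move=> Ac cp X0 XE; exists c; split=> //; exists (\sum_i a i *: fvec F i).
apply/funext => f; rewrite /on_smooth; case: asboolP => [sf|/X0 //].
have df := lrep_diff Ac cp sf.
rewrite XE // deriveE // linear_sum; apply: eq_bigr => i _.
by rewrite linearZ /cderiv deriveE.
Qed.

Lemma tangent_lin p (X Y : (N -> R) -> R) (a : R) : tangent A p X ->
  tangent A p Y -> tangent A p (a *: X + Y).
Proof.
move=> tX tY; have [c Ac cp] := atlas_cover p.
apply: (tangent_mk (a := fun i => a * X (fcoord F i \o c) + Y (fcoord F i \o c)) Ac cp).
  move=> f sf; rewrite -[LHS]/(a * X f + Y f).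
  by rewrite (tangent_off tX sf) (tangent_off tY sf) mulr0 addr0.
move=> f sf; rewrite -[LHS]/(a * X f + Y f).
rewrite (tangentE tX Ac cp sf) (tangentE tY Ac cp sf) mulr_sumr -big_split /=.
by apply: eq_bigr => i _; rewrite mulrDl mulrA.
Qed.

Lemma tangent0 p : tangent A p 0.
Proof.
have [c Ac cp] := atlas_cover p.
apply: (tangent_mk (a := fun i => 0) Ac cp) => // f sf.
by rewrite big1 // => i _; rewrite mul0r.
Qed.

(** * Vector fields and their bracket *)

Local Notation field := (field_along A A id).
Implicit Types X Y : N -> (N -> R) -> R.

Lemma near_tangentE X c p f : (forall q, tangent A q (X q)) -> A c -> cdom c p ->
  smooth_at A p f ->
  near_at p (fun q => (\sum_i der X (fcoord F i \o c) * cderiv c (fvec F i) f) q =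
    der X f q).
Proof.
move=> tX Ac cp sf.
apply: near_at_sub (near_atI (near_at_dom Ac cp) (smooth_near sf)) => q [cq sq].
by rewrite fct_sumE /der (tangentE (tX q) Ac cq sq).
Qed.

Lemma field_chart X : (forall q, tangent A q (X q)) ->
  (forall p, exists c, [/\ A c, cdom c p &
    forall i, smooth_at A p (der X (fcoord F i \o c))]) -> field X.
Proof.
move=> tX sX p; split; first exact: tX.
move=> f sf; have [c [Ac cp sc]] := sX p.
apply: smooth_ext (near_tangentE tX Ac cp sf) _.
by apply: smooth_sum => i; apply: smoothM => //; exact: smooth_cderiv.
Qed.

Lemma lieE X Y p f : smooth_at A p f ->
  lie A X Y p f = X p (der Y f) - Y p (der X f).
Proof. exact: on_smoothE. Qed.

(** The second order terms of X (Y f) - Y (X f) cancel because mixed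
derivatives commute, so that the bracket is a first order operator. *)
Lemma lie_field X Y : field X -> field Y -> field (lie A X Y).
Proof.
move=> fX fY.
have tX q : tangent A q (X q) by have [] := fX q.
have tY q : tangent A q (Y q) by have [] := fY q.
have sX q f : smooth_at A q f -> smooth_at A q (der X f) by have [_] := fX q; apply.
have sY q f : smooth_at A q f -> smooth_at A q (der Y f) by have [_] := fY q; apply.
have second (V W : N -> (N -> R) -> R) q c f : (forall q, tangent A q (V q)) ->
    (forall q, tangent A q (W q)) -> (forall q f, smooth_at A q f -> smooth_at A q (der W f)) ->
    A c -> cdom c q -> smooth_at A q f ->
    V q (der W f) =
      \sum_i V q (der W (fcoord F i \o c)) * cderiv c (fvec F i) f q +
      \sum_i \sum_j V q (fcoord F j \o c) * W q (fcoord F i \o c) *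
        cderiv c (fvec F j) (cderiv c (fvec F i) f) q.
  move=> tV tW sW Ac cq sf.
  rewrite -(tangent_near (tV q) (near_tangentE tW Ac cq sf)).
  rewrite (tangent_sum (tV q)); last first.
    move=> i; apply: smoothM; last exact: smooth_cderiv.
    exact/sW/smooth_coord.
  rewrite -big_split; apply: eq_bigr => i _ /=.
  rewrite (tangentM (tV q)); last 2 first.
  - exact/sW/smooth_coord.
  - exact: smooth_cderiv.
  rewrite addrC [cderiv _ _ _ _ * _]mulrC; congr (_ + _).
  rewrite (tangentE (tV q) Ac cq (smooth_cderiv _ Ac cq sf)) mulr_sumr.
  by apply: eq_bigr => j _; rewrite mulrCA mulrA.
move=> p; split; last first.
  move=> f sf; apply: (@smooth_ext p (der X (der Y f) - der Y (der X f))).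
    by apply: near_at_sub (smooth_near sf) => q sq; rewrite [RHS](lieE _ _ sq).
  by apply: smoothD; [apply/sX/sY|apply/smoothN/sY/sX].
have [c Ac cp] := atlas_cover p.
apply: (tangent_mk (a := fun i => X p (der Y (fcoord F i \o c)) -
    Y p (der X (fcoord F i \o c))) Ac cp).
  by move=> f sf; rewrite /lie /on_smooth asboolF.
move=> f sf; rewrite lieE // (second X Y p c f) // (second Y X p c f) //.
rewrite opprD addrACA; set a := (X in _ + X = _).
have -> : a = 0.
  apply/eqP; rewrite subr_eq0; apply/eqP; rewrite exchange_big /=.
  apply: eq_bigr => i _; apply: eq_bigr => j _.
  by rewrite cderivC // [X p _ * _]mulrC.
by rewrite addr0 -sumrB; apply: eq_bigr => i _; rewrite mulrBl.
Qed.

End Manifold.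

Arguments near_at {R E N} A p Q.

Section FieldsAlong.
Context {R : realType} {E F' : normedModType R} {I J : finType}.
Context {FE : frame E I} {FF : frame F' J} {K N : Type}.
Context {B : set (chart E K)} {A : set (chart F' N)} {g : K -> N}.
Hypotheses (hB : good_atlas FE B) (hA : good_atlas FF A).
Implicit Types X Y : K -> (N -> R) -> R.

Lemma field_ext X Y : field_along B A g X -> field_along B A g Y ->
  (forall u f, smooth_at A (g u) f -> X u f = Y u f) -> X = Y.
Proof.
move=> fX fY XY; apply/funext => u.
by apply: (tangent_ext (fX u).1 (fY u).1) => f; exact: XY.
Qed.

Lemma fieldD X Y : field_along B A g X -> field_along B A g Y ->
  field_along B A g (X + Y).
Proof.
move=> fX fY u; split=> [|f sf].
  rewrite -[(X + Y) u]/(X u + Y u) -[X u]scale1r.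
  by apply: (tangent_lin hA); [exact: (fX u).1|exact: (fY u).1].
by apply: (smoothD hB); [exact: (fX u).2|exact: (fY u).2].
Qed.

Lemma field_scale X (h : K -> R) : smooth B h -> field_along B A g X ->
  field_along B A g (fscale h X).
Proof.
move=> sh fX u; split=> [|f sf].
  rewrite /fscale -[_ *: _]addr0; apply: (tangent_lin hA); first exact: (fX u).1.
  exact: tangent0 hA _.
by apply: (smoothM hB); [exact: sh|exact: (fX u).2].
Qed.

Lemma fieldZ X (a : R) : field_along B A g X -> field_along B A g (a *: X).
Proof. by apply: field_scale => u; exact: smooth_cst hB _ _. Qed.

Lemma fieldN X : field_along B A g X -> field_along B A g (- X).
Proof. by rewrite -scaleN1r; exact: fieldZ. Qed.

Lemma fieldB X Y : field_along B A g X -> field_along B A g Y ->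
  field_along B A g (X - Y).
Proof. by move=> fX fY; apply: fieldD => //; exact: fieldN. Qed.

Lemma field0 : field_along B A g 0.
Proof.
by move=> u; split=> [|f _]; [exact: tangent0 hA _|exact: smooth_cst hB _ 0].
Qed.

End FieldsAlong.

(** * The slit tangent bundle *)

Section Frames.
Context {R : realType} {n : nat}.

Definition row_coord (i : 'I_n) (x : 'rV[R]_n) : R := x 0 i.

Fact row_coord_linear i : linear (row_coord i).
Proof. by move=> a x y; rewrite /row_coord !mxE. Qed.
HB.instance Definition _ i :=
  GRing.isLinear.Build R 'rV[R]_n R _ (row_coord i) (row_coord_linear i).

Fact row_coord_sum (x : 'rV[R]_n) : x = \sum_i row_coord i x *: delta_mx 0 i.
Proof. exact: row_sum_delta. Qed.

Definition row_frame : frame 'rV[R]_n 'I_n :=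
  @Frame R _ 'I_n (delta_mx 0) (fun i => row_coord i : {linear _ -> _})
    (@coord_continuous R 1 n 0) row_coord_sum.

Definition pair_vec (k : 'I_n + 'I_n) : 'rV[R]_n * 'rV[R]_n :=
  match k with inl i => (delta_mx 0 i, 0) | inr i => (0, delta_mx 0 i) end.

Definition pair_coord (k : 'I_n + 'I_n) (z : 'rV[R]_n * 'rV[R]_n) : R :=
  match k with inl i => z.1 0 i | inr i => z.2 0 i end.

Fact pair_coord_linear k : linear (pair_coord k).
Proof. by case: k => i a x y; rewrite /= !mxE. Qed.
HB.instance Definition _ k :=
  GRing.isLinear.Build R ('rV[R]_n * 'rV[R]_n)%type R _ (pair_coord k)
    (pair_coord_linear k).

Fact pair_coord_continuous k : continuous (pair_coord k).
Proof.
case: k => i z.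
  apply: (@continuous_comp _ _ _ fst (fun x : 'rV[R]_n => x 0 i)).
    exact: cvg_fst.
  exact: coord_continuous.
apply: (@continuous_comp _ _ _ snd (fun x : 'rV[R]_n => x 0 i)).
  exact: cvg_snd.
exact: coord_continuous.
Qed.

Fact pair_coord_sum z : z = \sum_k pair_coord k z *: pair_vec k.
Proof.
case: z => x y; rewrite big_sumType /= (_ : (x, y) = (x, 0) + (0, y)); last first.
  by rewrite -[RHS]/(x + 0, 0 + y) addr0 add0r.
congr (_ + _).
  rewrite {1}(row_sum_delta x); elim/big_ind2 : _ => //.
    by move=> a _ b _ <- <-; rewrite -[RHS]/(a + b, 0 + 0) addr0.
  by move=> i _; rewrite -[RHS]/(x 0 i *: delta_mx 0 i, x 0 i *: 0) scaler0.
rewrite {1}(row_sum_delta y); elim/big_ind2 : _ => //.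
  by move=> a _ b _ <- <-; rewrite -[RHS]/(0 + 0, a + b) addr0.
by move=> i _; rewrite -[RHS]/(y 0 i *: 0, y 0 i *: delta_mx 0 i) scaler0.
Qed.

Definition pair_frame : frame ('rV[R]_n * 'rV[R]_n)%type ('I_n + 'I_n)%type :=
  @Frame R _ _ pair_vec (fun k => pair_coord k : {linear _ -> _})
    pair_coord_continuous pair_coord_sum.

End Frames.

Section Slit.
Context {R : realType} {n : nat} {M : topologicalType}.
Context {A : set (chart 'rV[R]_n M)} (hA : smooth_atlas A).
Notation sTM := (slit A).
Notation B := (@slit_atlas R n M A).
Notation sc := (slit_chart A).
Notation prj := (@bproj R n M A).
Implicit Types (c d : chart 'rV[R]_n M) (u : sTM) (f g : M -> R).
Implicit Types (w : (M -> R) -> R) (V : set 'rV[R]_n).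

Lemma base_atlas : good_atlas row_frame A.
Proof.
case: hA => cov cA tr; split=> //.
- by move=> c /cA[].
- move=> c d Ac Ad; have [oc _ _ op] := cA _ Ac; have [od _ _ _] := cA _ Ad.
  by apply: op; [exact: openI|exact: subIsetl].
Qed.

(** The function on the tangent bundle induced by the differential of f; for a
coordinate f = x^i of M it is the fibre coordinate y^i. *)
Definition dot f : sTM -> R := fun u => tvec u f.

Lemma slit_eq u u' : bproj u = bproj u' -> tvec u = tvec u' -> u = u'.
Proof.
case: u => [[p X tX] /= nX]; case: u' => [[p' X' tX'] /= nX'].
rewrite /bproj /= => e1 e2; move: tX nX tX' nX'; rewrite -e1 -e2 => tX nX tX' nX'.
have e : tX = tX' by exact: Prop_irrelevance.
by move: nX'; rewrite -e /= => nX'; congr Slit; exact: Prop_irrelevance.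
Qed.

Lemma slit_tangent u : tangent A (bproj u) (tvec u).
Proof. exact: tvecP. Qed.

Lemma tangent_coord_vec c p (y : 'rV[R]_n) : A c -> cdom c p -> exists w,
  [/\ tangent A p w, forall i, w (row_coord i \o c) = y 0 i &
    forall f, smooth_at A p f -> w f = cderiv c y f p].
Proof.
move=> Ac cp; exists (on_smooth A p (fun f => cderiv c y f p)); split.
- by exists c; split=> //; exists y.
- move=> i; rewrite on_smoothE; last exact: (smooth_coord base_atlas i Ac cp).
  exact: (cderiv_coord base_atlas y i Ac cp).
- by move=> f sf; rewrite on_smoothE.
Qed.

Lemma slit_point c p (y : 'rV[R]_n) : A c -> cdom c p -> y != 0 ->
  exists u, bproj u = p /\ sc c u = (c p, y).
Proof.
move=> Ac cp y0; have [w [tw wc wf]] := tangent_coord_vec y Ac cp.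
have w0 : w <> 0.
  move=> e; move/eqP : y0; apply; apply/rowP => i.
  by rewrite -wc e mxE.
exists (@Slit _ _ _ A (TVec tw) w0); split=> //=; congr pair.
by apply/rowP => i; rewrite mxE; exact: wc.
Qed.

Lemma slit_chart_neq0 c u : A c -> cdom c (bproj u) -> (sc c u).2 != 0.
Proof.
move=> Ac cu; apply/eqP => /rowP e; apply: (slit_neq0 (s := u)).
apply: (tangent_coord_ext base_atlas Ac cu (slit_tangent u)).
  exact: tangent0 base_atlas _.
by move=> i; have := e i; rewrite /= !mxE.
Qed.

Lemma slit_chart_inj c : A c -> {in cdom (sc c) &, injective (sc c)}.
Proof.
move=> Ac u u' /[!inE] /= cu cu' [e1 /rowP e2].
have e : bproj u = bproj u'.
  by case: base_atlas => _ inj _ _; apply: (inj _ Ac) e1; rewrite inE.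
apply: slit_eq => //.
apply: (tangent_coord_ext base_atlas Ac cu (slit_tangent u)).
  by rewrite e; exact: slit_tangent.
by move=> i; have := e2 i; rewrite !mxE.
Qed.

(** The image, in an induced chart, of the nonzero vectors based in V. *)
Definition over V := [set z : 'rV[R]_n * 'rV[R]_n | V z.1 /\ z.2 != 0].

Lemma open_over V : open V -> open (over V).
Proof.
move=> oV; rewrite (_ : over V = fst @^-1` V `&` snd @^-1` [set y | y != 0]) //.
apply: openI; apply: open_comp => //.
- by move=> z _; exact: cvg_fst.
- by move=> z _; exact: cvg_snd.
rewrite (_ : [set _ | _] = (fun y : 'rV[R]_n => `|y|) @^-1` [set t | 0 < t]).
  apply: open_comp; last exact: open_gt.
  by move=> y _; exact: norm_continuous.
by apply/seteqP; split=> y /=; rewrite normr_gt0.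
Qed.

Lemma over_image c V z : A c -> V `<=` c @` cdom c -> over V z ->
  exists u, [/\ cdom c (bproj u), V (c (bproj u)) & sc c u = z].
Proof.
move=> Ac Vc [/[dup] Vz /Vc[p cp e] z0].
have [u [pu uz]] := slit_point Ac cp z0.
by exists u; rewrite pu uz e; split=> //; case: (z).
Qed.

Lemma over_slit_chart c V u : A c -> cdom c (bproj u) -> V (c (bproj u)) ->
  over V (sc c u).
Proof. by move=> Ac cu Vu; split=> //; exact: slit_chart_neq0. Qed.

Lemma smooth_on c V f q : A c -> open V -> V `<=` c @` cdom c ->
  Coo V (lrep c f) -> cdom c q -> V (c q) -> smooth_at A q f.
Proof. by move=> Ac oV Vc Vf cq Vq; exists c; split=> //; exists V. Qed.

(** In the chart induced by (x^i), f o pi is f(x) and dot f is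
sum_j y^j (d f / d x^j)(x). *)
Lemma Coo_over c V f : A c -> open V -> V `<=` c @` cdom c ->
  Coo V (lrep c f) ->
  Coo (over V) (lrep (sc c) (f \o prj)) /\
  Coo (over V) (lrep (sc c) (dot f)).
Proof.
move=> Ac oV Vc Vf; have oS := open_over oV.
have Cfst (h : 'rV[R]_n -> R) : Coo V h -> Coo (over V) (h \o fst).
  move=> Vh; apply: (Coo_comp (F := row_frame) oS oV _ _ Vh) => [z []//|i].
  exact: (Coo_linear _ (@fcoord_cont _ _ _ (@pair_frame R n) (inl i))).
have inj := slit_chart_inj Ac.
split.
  apply: (Coo_ext oS _ (Cfst _ Vf)) => z /(over_image Ac Vc)[u [cu Vu <-]] /=.
  by rewrite (lrepE base_atlas _ Ac cu) lrep_inj.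
apply: (Coo_ext oS _ (_ : Coo _ (\sum_i ((pair_coord (inr i) : _ -> R) *
    ('D_(delta_mx 0 i) (lrep c f) \o fst))))).
  move=> z /(over_image Ac Vc)[u [cu Vu <-]].
  rewrite lrep_inj // fct_sumE /dot.
  have sf := smooth_on Ac oV Vc Vf cu Vu.
  rewrite (tangentE base_atlas (slit_tangent u) Ac cu sf).
  apply: eq_bigr => i _; rewrite -[LHS]/(pair_coord _ _ * _) /= mxE.
  by [].
apply: Coo_sum => // i; apply: CooM => //; last exact/Cfst/Coo_derive.
exact: (Coo_linear _ (@fcoord_cont _ _ _ (@pair_frame R n) (inr i))).
Qed.

Lemma slit_good_atlas : good_atlas pair_frame B.
Proof.
have image c d : A c -> A d -> sc c @`
    (cdom (sc c) `&` cdom (sc d)) =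
    over (c @` (cdom c `&` cdom d)).
  move=> Ac Ad; apply/seteqP; split=> [_ [u [cu du] <-]|z [[p [cp dp] e] z0]].
    by apply: over_slit_chart => //; exists (bproj u).
  have [u [pu uz]] := slit_point Ac cp z0.
  exists u; first by split; rewrite /= pu.
  by rewrite uz e; case: (z).
split.
- move=> u; have [c Ac cu] := atlas_cover base_atlas (bproj u).
  by exists (sc c) => //; exists c.
- by move=> _ [c Ac <-]; exact: slit_chart_inj.
- move=> _ _ [c Ac <-] [d Ad <-]; rewrite image //; apply: open_over.
  exact: (chart_open base_atlas Ac Ad).
- move=> _ _ [c Ac <-] [d Ad <-] k; rewrite image //.
  have oW := chart_open base_atlas Ac Ad.
  have Wc : c @` (cdom c `&` cdom d) `<=` c @` cdom c.
    by move=> _ [q [cq _] <-]; exists q.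
  have cd i : Coo (c @` (cdom c `&` cdom d)) (lrep c (row_coord i \o d)).
    by case: base_atlas => _ _ _ h; exact: (h c d Ac Ad i).
  case: k => i; first exact: (Coo_over Ac oW Wc (cd i)).1.
  rewrite (_ : _ \o _ = dot (row_coord i \o d)); first exact: (Coo_over Ac oW Wc (cd i)).2.
  by apply/funext => u; rewrite /= mxE.
Qed.

Lemma slit_atlas_chart c : A c -> B (sc c).
Proof. by move=> Ac; exists c. Qed.

Lemma smooth_bproj_dot u f : smooth_at A (bproj u) f ->
  smooth_at B u (f \o prj) /\ smooth_at B u (dot f).
Proof.
move=> sf; have [c Ac cu] := atlas_cover base_atlas (bproj u).
have [V [oV Vu Vc Vf]] := smooth_in base_atlas Ac cu sf.
have [C1 C2] := Coo_over Ac oV Vc Vf.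
have sub : over V `<=` sc c @` cdom (sc c).
  by move=> z /(over_image Ac Vc)[u' [cu' _ <-]]; exists u'.
have oS := open_over oV; have Su := over_slit_chart Ac cu Vu.
by split; exists (sc c); split=> //; (try by exists c); exists (over V).
Qed.

Lemma smooth_bproj u f : smooth_at A (bproj u) f ->
  smooth_at B u (f \o prj).
Proof. by move=> /smooth_bproj_dot[]. Qed.

Lemma smooth_dot u f : smooth_at A (bproj u) f -> smooth_at B u (dot f).
Proof. by move=> /smooth_bproj_dot[]. Qed.

Lemma near_bproj u (Q : M -> Prop) : near_at A (bproj u) Q ->
  near_at B u (fun u' => Q (bproj u')).
Proof.
move=> nQ; have [c Ac cu] := atlas_cover base_atlas (bproj u).
have [V [oV Vu Vc VQ]] := near_in base_atlas Ac cu nQ.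
exists (sc c); split=> //; first by exists c.
exists (over V); split.
- exact: open_over.
- exact: over_slit_chart.
- by move=> z /(over_image Ac Vc)[u' [cu' _ <-]]; exists u'.
- by move=> u' cu' [Vu' _]; exact: VQ.
Qed.

Lemma slit_coord c k : pair_coord k \o sc c =
  match k with inl i => (row_coord i \o c) \o prj
             | inr i => dot (row_coord i \o c) end.
Proof. by apply/funext => u; case: k => i //=; rewrite mxE. Qed.

(** The functions f o pi and dot f include the coordinates of the slit tangent
bundle, so that they detect its tangent vectors. *)
Lemma slit_tangent_ext u (X Y : (sTM -> R) -> R) :
  tangent B u X -> tangent B u Y ->
  (forall f, smooth_at A (bproj u) f -> X (f \o prj) = Y (f \o prj)) ->
  (forall f, smooth_at A (bproj u) f -> X (dot f) = Y (dot f)) -> X = Y.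
Proof.
move=> tX tY XY1 XY2; have [c Ac cu] := atlas_cover base_atlas (bproj u).
apply: (tangent_coord_ext slit_good_atlas (slit_atlas_chart Ac) cu tX tY) => k.
rewrite [fcoord _ k \o _](slit_coord c k).
by case: k => i; [apply: XY1|apply: XY2]; exact: (smooth_coord base_atlas i Ac cu).
Qed.

(** * The vertical lift *)

Lemma fibre_lineE (F : sTM -> R) u w t u' : bproj u' = bproj u ->
  tvec u' = tvec u + t *: w -> fibre_line F u w t = F u'.
Proof.
move=> e1 e2; apply: xget_unique; first by exists u'.
by move=> _ [u2 [e3 e4] <-]; congr F; apply: slit_eq; rewrite ?e1 ?e2.
Qed.

(** The line u + t w avoids the zero vector for small t. *)
Lemma near_fibre u w : tangent A (bproj u) w ->
  \forall t \near (0 : R), exists2 u' : sTM, bproj u' = bproj u &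
    tvec u' = tvec u + t *: w.
Proof.
move=> tw.
have [f nf] : exists f, tvec u f != 0.
  apply/not_existsP => h; apply: (slit_neq0 (s := u)); apply/funext => f.
  by apply/eqP; have /negP := h f; rewrite negbK.
have cf : (fun t : R => tvec u f + t * w f) @ (0 : R) --> tvec u f + 0 * w f.
  apply: cvgD; first exact: cvg_cst.
  by apply: cvgM; [exact: cvg_id|exact: cvg_cst].
have : \forall t \near (0 : R), tvec u f + t * w f != 0.
  apply: (cf [set x : R | x != 0]).
  apply: open_nbhs_nbhs; split; last by rewrite /= mul0r addr0.
  exact: open_neq.
apply: filterS => t nt.
have tt : tangent A (bproj u) (tvec u + t *: w).
  by rewrite addrC; apply: (tangent_lin base_atlas) => //; exact: slit_tangent.
have nz : tvec u + t *: w <> 0.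
  by move=> e; move/eqP : nt; apply; rewrite -[LHS]/((tvec u + t *: w) f) e.
by exists (@Slit _ _ _ A (TVec tt) nz).
Qed.

Lemma vlift_cderiv u w c (F : sTM -> R) : tangent A (bproj u) w -> A c ->
  cdom c (bproj u) -> smooth_at B u F ->
  vlift u w F = cderiv (sc c) (0, \row_i w (fun q => c q 0 i)) F u.
Proof.
move=> tw Ac cu sF; rewrite /vlift on_smoothE // derive1E.
set v := (0, _).
rewrite (near_eq_derive
    (g := fun t : R => lrep (sc c) F (t *: v + sc c u))); last first.
  apply: filterS (near_fibre tw) => t [u' e1 e2].
  rewrite (fibre_lineE _ e1 e2).
  have <- : sc c u' = t *: v + sc c u.
    congr pair; first by rewrite /= scaler0 add0r e1.
    by apply/rowP => i; rewrite /= !mxE e2 addrC.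
  by rewrite lrep_inj //=; [exact: slit_chart_inj|rewrite e1].
rewrite /cderiv.
have e : 0 *: v + sc c u = sc c u by rewrite scale0r add0r.
have dv : derivable (lrep (sc c) F) (0 *: v + sc c u) v.
  apply: diff_derivable; rewrite e.
  exact: (lrep_diff slit_good_atlas (slit_atlas_chart Ac) cu sF).
by have [_ ->] := is_derive_line dv; rewrite e.
Qed.

Lemma tangent_vlift u w : tangent A (bproj u) w -> tangent B u (vlift u w).
Proof.
move=> tw; have [c Ac cu] := atlas_cover base_atlas (bproj u).
exists (sc c); split=> //; first by exists c.
exists (0, \row_i w (fun q => c q 0 i)); apply/funext => F.
rewrite [RHS]/on_smooth; case: asboolP => sF; first exact: vlift_cderiv.
by rewrite /vlift /on_smooth asboolF.
Qed.

Lemma vlift_bproj u w f : tangent A (bproj u) w -> smooth_at A (bproj u) f ->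
  vlift u w (f \o prj) = 0.
Proof.
move=> tw sf; rewrite /vlift on_smoothE; last exact: smooth_bproj.
rewrite derive1E (near_eq_derive (g := cst (f (bproj u)))) ?derive_cst //.
by apply: filterS (near_fibre tw) => t [u' e1 e2]; rewrite (fibre_lineE _ e1 e2) /= e1.
Qed.

Lemma derive_affine (a b : R) : 'D_1 (fun t : R => a + t * b) 0 = b.
Proof.
have -> : (fun t : R => a + t * b) = (fun t => (id : R -> R) (t *: b + a)).
  by apply/funext => t; rewrite addrC.
have di : derivable (id : R -> R) (0 *: b + a) b by exact: derivable_id.
have [_ ->] := is_derive_line di.
exact: derive_id.
Qed.

Lemma vlift_dot u w f : tangent A (bproj u) w -> smooth_at A (bproj u) f ->
  vlift u w (dot f) = w f.
Proof.
move=> tw sf; rewrite /vlift on_smoothE; last exact: smooth_dot.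
rewrite derive1E (near_eq_derive (g := fun t : R => tvec u f + t * w f)).
  exact: derive_affine.
by apply: filterS (near_fibre tw) => t [u' e1 e2]; rewrite (fibre_lineE _ e1 e2) /dot e2.
Qed.

(** Euler's relation: along the ray through u, l is (1 + t) l(u). *)
Lemma vlift_poshom (l : tbundle A -> R) u : smooth_poshom1 l ->
  vlift u (tvec u) (restr l) = l u.
Proof.
move=> [sl hl]; rewrite /vlift on_smoothE; last exact: sl.
rewrite derive1E (near_eq_derive (g := fun t : R => l u + t * l u)).
  exact: derive_affine.
have n1 : \forall t \near (0 : R), 0 < 1 + t.
  apply: filterS (_ : \forall t \near (0 : R), -1 < t) => [t|].
    by rewrite -ltrBlDl sub0r.
  by apply: lt_nbhsr; rewrite oppr_lt0.
apply: filterS2 n1 (near_fibre (slit_tangent u)) => t t1 [u' e1 e2].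
rewrite (fibre_lineE _ e1 e2) /restr (hl (1 + t) u u') //.
  by rewrite mulrDl mul1r.
by rewrite e2 scalerDl scale1r.
Qed.

End Slit.

(** * Vector fields as derivations *)

Section Operators.
Context {R : realType} {K N : Type}.
Implicit Types (X Y : K -> (N -> R) -> R) (h : K -> R).

Lemma fieldDE X Y u f : (X + Y) u f = X u f + Y u f.
Proof. by []. Qed.

Lemma fieldNE X u f : (- X) u f = - X u f.
Proof. by []. Qed.

Lemma fieldZE (a : R) X u f : (a *: X) u f = a * X u f.
Proof. by []. Qed.

Lemma fscaleE h X u f : fscale h X u f = h u * X u f.
Proof. by []. Qed.

Lemma field0E u f : (0 : K -> (N -> R) -> R) u f = 0.
Proof. by []. Qed.

Definition fieldE := (fieldDE, fieldNE, fieldZE, fscaleE, field0E).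

Lemma derDE X Y f : der (X + Y) f = der X f + der Y f.
Proof. by []. Qed.

Lemma derNE X f : der (- X) f = - der X f.
Proof. by []. Qed.

Lemma der_fscaleE h X f : der (fscale h X) f = h * der X f.
Proof. by []. Qed.

Lemma fscale_cst (a : R) X : fscale (cst a) X = a *: X.
Proof. by []. Qed.

End Operators.

Section LieAlgebra.
Context {R : realType} {E : normedModType R} {I : finType} {F : frame E I}.
Context {N : Type} {A : set (chart E N)} (hA : good_atlas F A).
Local Notation field := (field_along A A id).
Implicit Types (X Y Z : N -> (N -> R) -> R) (f g h : N -> R) (p : N).

Lemma vectD X p f g : field X -> smooth_at A p f -> smooth_at A p g ->
  X p (f + g) = X p f + X p g.
Proof. by move=> fX; exact: (tangentD hA (fX p).1). Qed.

Lemma vectN X p f : field X -> smooth_at A p f -> X p (- f) = - X p f.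
Proof.
move=> fX sf; apply/eqP; rewrite -addr_eq0 -vectD //; last exact: (smoothN hA).
by rewrite addNr; apply/eqP; exact: (tangent_cst hA (fX p).1).
Qed.

Lemma vectB X p f g : field X -> smooth_at A p f -> smooth_at A p g ->
  X p (f - g) = X p f - X p g.
Proof. by move=> fX sf sg; rewrite vectD ?vectN //; exact: (smoothN hA). Qed.

Lemma vectM X p f g : field X -> smooth_at A p f -> smooth_at A p g ->
  X p (f * g) = f p * X p g + g p * X p f.
Proof. by move=> fX; exact: (tangentM hA (fX p).1). Qed.

Lemma vect_near X p f g : field X -> near_at A p (fun q => f q = g q) ->
  X p f = X p g.
Proof. by move=> fX; exact: (tangent_near hA (fX p).1). Qed.

Lemma smooth_der X p f : field X -> smooth_at A p f -> smooth_at A p (der X f).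
Proof. by move=> fX; exact: (fX p).2. Qed.

Lemma vect_lie X Y Z p f : field X -> field Y -> field Z -> smooth_at A p f ->
  X p (der (lie A Y Z) f) = X p (der Y (der Z f)) - X p (der Z (der Y f)).
Proof.
move=> fX fY fZ sf.
rewrite -vectB //; [|exact/smooth_der/smooth_der|exact/smooth_der/smooth_der].
apply: vect_near => //.
by apply: near_at_sub (smooth_near sf) => q sq; exact: (lieE _ _ sq).
Qed.

Lemma lieC X Y : field X -> field Y -> lie A X Y = - lie A Y X.
Proof.
move=> fX fY; apply: (field_ext (g := id) (lie_field hA fX fY)).
  exact: (fieldN hA hA (lie_field hA fY fX)).
by move=> p f sf; rewrite fieldNE !lieE // opprB.
Qed.

Lemma lieDr X Y Z : field X -> field Y -> field Z ->
  lie A X (Y + Z) = lie A X Y + lie A X Z.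
Proof.
move=> fX fY fZ; have fYZ := fieldD hA hA fY fZ.
apply: (field_ext (g := id) (lie_field hA fX fYZ)).
  exact: (fieldD hA hA (lie_field hA fX fY) (lie_field hA fX fZ)).
move=> p f sf; rewrite fieldDE !lieE // derDE fieldDE vectD //; try exact: smooth_der.
by ring.
Qed.

Lemma lie_fscale X Y h : field X -> field Y -> smooth A h ->
  lie A X (fscale h Y) = fscale (der X h) Y + fscale h (lie A X Y).
Proof.
move=> fX fY sh; have fhY := field_scale hA hA sh fY.
have sXh : smooth A (der X h) by move=> p; exact: smooth_der.
have fL := lie_field hA fX fY.
apply: (field_ext (g := id) (lie_field hA fX fhY)).
  exact: (fieldD hA hA (field_scale hA hA sXh fY) (field_scale hA hA sh fL)).
move=> p f sf; rewrite fieldDE !fscaleE !lieE // der_fscaleE fscaleE vectM //; last exact: smooth_der.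
by rewrite /der; ring.
Qed.

Lemma lieZr X Y (a : R) : field X -> field Y -> lie A X (a *: Y) = a *: lie A X Y.
Proof.
move=> fX fY; rewrite -fscale_cst lie_fscale //; last by move=> p; exact: (smooth_cst hA).
rewrite fscale_cst (_ : fscale _ Y = 0) ?add0r //.
apply/funext => p; apply/funext => f.
by rewrite fscaleE /der (tangent_cst hA (fX p).1) mul0r.
Qed.

Lemma lieNr X Y : field X -> field Y -> lie A X (- Y) = - lie A X Y.
Proof. by move=> fX fY; rewrite -[- Y]scaleN1r lieZr // scaleN1r. Qed.

Lemma lieBr X Y Z : field X -> field Y -> field Z ->
  lie A X (Y - Z) = lie A X Y - lie A X Z.
Proof. by move=> fX fY fZ; rewrite lieDr ?lieNr //; exact: (fieldN hA hA). Qed.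

Lemma lieBl X Y Z : field X -> field Y -> field Z ->
  lie A (X - Y) Z = lie A X Z - lie A Y Z.
Proof.
move=> fX fY fZ; rewrite lieC ?lieBr //; last exact: (fieldB hA hA).
by rewrite opprB [lie A X Z]lieC // [lie A Y Z]lieC // opprK addrC.
Qed.

Lemma lie_self X : field X -> lie A X X = 0.
Proof.
move=> fX; apply: (field_ext (g := id) (lie_field hA fX fX)).
  exact: (field0 hA hA).
by move=> p f sf; rewrite lieE // subrr.
Qed.

Lemma lie0 X : field X -> lie A 0 X = 0.
Proof.
by move=> fX; rewrite -{1}(subrr X) lieBl // subrr.
Qed.

Lemma jacobi X Y Z : field X -> field Y -> field Z ->
  lie A X (lie A Y Z) = lie A (lie A X Y) Z + lie A Y (lie A X Z).
Proof.
move=> fX fY fZ.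
have fXY := lie_field hA fX fY.
have fYZ := lie_field hA fY fZ.
have fXZ := lie_field hA fX fZ.
apply: (field_ext (g := id) (lie_field hA fX fYZ)).
  exact: (fieldD hA hA (lie_field hA fXY fZ) (lie_field hA fY fXZ)).
move=> p f sf; rewrite fieldDE !lieE //; try exact: smooth_der.
rewrite !vect_lie //.
by ring.
Qed.

End LieAlgebra.

(** * Vertical lift and projection of fields *)

Section SlitFields.
Context {R : realType} {n : nat} {M : topologicalType}.
Context {A : set (chart 'rV[R]_n M)} (hA : smooth_atlas A).
Notation sTM := (slit A).
Notation B := (@slit_atlas R n M A).
Notation prj := (@bproj R n M A).
Implicit Types (u : sTM) (f g : M -> R) (h : sTM -> R).
Implicit Types (X Y : sTM -> (sTM -> R) -> R) (P Q : sTM -> (M -> R) -> R).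

Let hM : good_atlas row_frame A := base_atlas hA.
Let hB : good_atlas pair_frame B := slit_good_atlas hA.

Lemma vfield_ext X Y : vfield X -> vfield Y ->
  (forall u f, smooth_at A (bproj u) f -> X u (f \o prj) = Y u (f \o prj)) ->
  (forall u f, smooth_at A (bproj u) f -> X u (dot f) = Y u (dot f)) -> X = Y.
Proof.
move=> vX vY e1 e2; apply/funext => u.
by apply: (slit_tangent_ext hA (vX u).1 (vY u).1) => f sf; [exact: e1|exact: e2].
Qed.

Lemma pvfield_ext P Q : pvfield P -> pvfield Q ->
  (forall u f, smooth_at A (bproj u) f -> P u f = Q u f) -> P = Q.
Proof. exact: (field_ext (g := prj)). Qed.

Lemma gamma_bproj P u f : pvfield P -> smooth_at A (bproj u) f ->
  gamma P u (f \o prj) = 0.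
Proof. by move=> pP; exact: (vlift_bproj hA (pP u).1). Qed.

Lemma gamma_dot P u f : pvfield P -> smooth_at A (bproj u) f ->
  gamma P u (dot f) = P u f.
Proof. by move=> pP; exact: (vlift_dot hA (pP u).1). Qed.

Lemma near_smooth_bproj u f : smooth_at A (bproj u) f ->
  near_at B u (fun u' => smooth_at A (bproj u') f).
Proof. by move=> sf; exact: (near_bproj hA (smooth_near sf)). Qed.

Lemma vfield_gamma P : pvfield P -> vfield (gamma P).
Proof.
move=> pP; apply: (field_chart hB) => [u|u]; first exact: (tangent_vlift hA (pP u).1).
have [c Ac cu] := atlas_cover hM (bproj u).
exists (slit_chart A c); split=> //; first by exists c.
have sc i : near_at B u (fun u' => smooth_at A (bproj u') (row_coord i \o c)).
  by apply: near_smooth_bproj; exact: (smooth_coord hM i Ac cu).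
move=> k; rewrite [fcoord _ k \o _](slit_coord c k); case: k => i.
  apply: (smooth_ext hB _ (smooth_cst hB u 0)).
  by apply: near_at_sub (sc i) => u' su'; rewrite /der gamma_bproj.
apply: (smooth_ext hB (f := der P (row_coord i \o c))).
  by apply: near_at_sub (sc i) => u' su'; rewrite /der gamma_dot.
by apply: (pP u).2; exact: (near_at_self (sc i)).
Qed.

Lemma rhoE X u f : smooth_at A (bproj u) f -> rho X u f = X u (f \o prj).
Proof. exact: on_smoothE. Qed.

Lemma cderiv_bproj c u k f : A c -> cdom c (bproj u) ->
  cderiv (slit_chart A c) (pair_vec k) (f \o prj) u =
  match k with inl i => cderiv c (delta_mx 0 i) f (bproj u) | inr i => 0 end.
Proof.
move=> Ac cu; rewrite /cderiv.
rewrite (near_eq_derive (g := lrep c f \o fst)); last first.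
  apply: (open_near (chart_dom_open hB (slit_atlas_chart Ac))); first by exists u.
  move=> _ [u' cu' <-] /=; rewrite (lrep_inj _ (slit_chart_inj hA Ac)) //.
  by rewrite (lrepE hM _ Ac).
case: k => i; first by [].
rewrite -[LHS]/('D_0 (lrep c f) (c (bproj u))).
exact: derive0.
Qed.

Lemma pvfield_rho X : vfield X -> pvfield (rho X).
Proof.
move=> vX u; split; last first.
  move=> f sf; apply: (smooth_ext hB (f := der X (f \o prj))).
    by apply: near_at_sub (near_smooth_bproj sf) => u' su'; rewrite [RHS]rhoE.
  by apply: (vX u).2; exact: smooth_bproj.
have [c Ac cu] := atlas_cover hM (bproj u).
apply: (tangent_mk hM (a := fun i => X u ((row_coord i \o c) \o prj)) Ac cu).
  by move=> f sf; rewrite /rho /on_smooth asboolF.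
move=> f sf; rewrite rhoE //.
rewrite (tangentE hB (vX u).1 (slit_atlas_chart Ac) cu (smooth_bproj hA sf)).
rewrite big_sumType /= [X in _ + X]big1 ?addr0; last first.
  by move=> i _; rewrite (cderiv_bproj (inr i) f Ac cu) mulr0.
by apply: eq_bigr => i _; rewrite (cderiv_bproj (inl i) f Ac cu).
Qed.

Lemma pvfield_eta : pvfield (@eta R n M A).
Proof. by move=> u; split; [exact: slit_tangent|exact: smooth_dot]. Qed.

Lemma vfield_liouville : vfield (@liouville R n M A).
Proof. exact/vfield_gamma/pvfield_eta. Qed.

Lemma gamma_inj P Q : pvfield P -> pvfield Q -> gamma P = gamma Q -> P = Q.
Proof.
move=> pP pQ e; apply: pvfield_ext => // u f sf.
by rewrite -gamma_dot // e gamma_dot.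
Qed.

(** A vertical vector has the components (0, a) in an induced chart; the vector
with components a on M is its preimage under the vertical lift. *)
Lemma vertical_gamma X : vfield X -> rho X = 0 ->
  exists2 P, pvfield P & gamma P = X.
Proof.
move=> vX rX; pose P u := on_smooth A (bproj u) (fun f => X u (dot f)).
have XP u : tangent A (bproj u) (P u) /\ vlift u (P u) = X u.
  have [c Ac cu] := atlas_cover hM (bproj u).
  have [w [tw wc _]] :=
    tangent_coord_vec hA (\row_i X u (dot (row_coord i \o c))) Ac cu.
  have sc i : smooth_at A (bproj u) (row_coord i \o c).
    exact: (smooth_coord hM i Ac cu).
  have wX : vlift u w = X u.
    apply: (tangent_coord_ext hB (slit_atlas_chart Ac) cu).
    - exact: (tangent_vlift hA tw).
    - exact: (vX u).1.
    move=> k; rewrite [fcoord _ k \o _](slit_coord c k); case: k => i.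
      by rewrite (vlift_bproj hA tw (sc i)) -rhoE // rX.
    by rewrite (vlift_dot hA tw (sc i)) wc mxE.
  suff -> : P u = w by [].
  apply/funext => f; have [sf|sf] := pselect (smooth_at A (bproj u) f).
    by rewrite /P on_smoothE // -wX (vlift_dot hA tw sf).
  by rewrite (tangent_off tw sf) /P /on_smooth asboolF.
exists P; last by apply/funext => u; exact: (XP u).2.
move=> u; split; first exact: (XP u).1.
move=> f sf; apply: (smooth_ext hB (f := der X (dot f))).
  by apply: near_at_sub (near_smooth_bproj sf) => u' su'; rewrite [RHS]on_smoothE.
by apply: (vX u).2; exact: smooth_dot.
Qed.

(** * Closure properties *)

Lemma vfieldD X Y : vfield X -> vfield Y -> vfield (X + Y).
Proof. exact: (fieldD hB hB). Qed.

Lemma vfieldN X : vfield X -> vfield (- X).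
Proof. exact: (fieldN hB hB). Qed.

Lemma vfieldZ (a : R) X : vfield X -> vfield (a *: X).
Proof. exact: (fieldZ hB hB). Qed.

Lemma vfield_scale h X : smooth B h -> vfield X -> vfield (fscale h X).
Proof. exact: (field_scale hB hB). Qed.

Lemma vfield_bracket X Y : vfield X -> vfield Y -> vfield (bracket X Y).
Proof. exact: (lie_field hB). Qed.

Lemma vfield_Jend X : vfield X -> vfield (Jend X).
Proof. by move=> vX; exact/vfield_gamma/pvfield_rho. Qed.

Lemma pvfieldD P Q : pvfield P -> pvfield Q -> pvfield (P + Q).
Proof. exact: (fieldD hB hM). Qed.

Lemma pvfieldN P : pvfield P -> pvfield (- P).
Proof. exact: (fieldN hB hM). Qed.

Lemma pvfieldZ (a : R) P : pvfield P -> pvfield (a *: P).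
Proof. exact: (fieldZ hB hM). Qed.

Lemma pvfield_scale h P : smooth B h -> pvfield P -> pvfield (fscale h P).
Proof. exact: (field_scale hB hM). Qed.

Lemma smooth_der_vfield X h : vfield X -> smooth B h -> smooth B (der X h).
Proof. by move=> vX sh u; exact: (vX u).2. Qed.

(* Fields are matched up to syntax: comparing two of them up to conversion would
unfold the operators down to limits. *)
Ltac known := match goal with
  | H : ?G' |- ?G => constr_eq G G'; exact H
  end.
(* Discharges the conditions that something is a field or a smooth function. *)
Ltac fld := first [known | lazymatch goal with
  | |- vfield (_ + _) => apply: vfieldD; fld
  | |- vfield (- _) => apply: vfieldN; fld
  | |- vfield (_ *: _) => apply: vfieldZ; fld
  | |- vfield (fscale _ _) => apply: vfield_scale; fld
  | |- vfield (bracket _ _) => apply: vfield_bracket; fld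
  | |- vfield (Jend _) => apply: vfield_Jend; fld
  | |- vfield (gamma _) => apply: vfield_gamma; fld
  | |- vfield (liouville (A:=_)) => exact: vfield_liouville
  | |- pvfield (_ + _) => apply: pvfieldD; fld
  | |- pvfield (- _) => apply: pvfieldN; fld
  | |- pvfield (_ *: _) => apply: pvfieldZ; fld
  | |- pvfield (fscale _ _) => apply: pvfield_scale; fld
  | |- pvfield (rho _) => apply: pvfield_rho; fld
  | |- pvfield (eta (A:=_)) => exact: pvfield_eta
  | |- smooth _ (der _ _) => apply: smooth_der_vfield; fld
  end].

(** * Linearity of gamma and rho *)

Lemma gammaD P Q : pvfield P -> pvfield Q -> gamma (P + Q) = gamma P + gamma Q.
Proof.
move=> pP pQ; apply: vfield_ext; [fld|fld| |] => u f sf; rewrite fieldDE.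
  by rewrite !(gamma_bproj _ sf); try fld; rewrite addr0.
by rewrite !(gamma_dot _ sf); try fld.
Qed.

Lemma gamma_scale h P : smooth B h -> pvfield P ->
  gamma (fscale h P) = fscale h (gamma P).
Proof.
move=> sh pP; apply: vfield_ext; [fld|fld| |] => u f sf; rewrite fscaleE.
  by rewrite !(gamma_bproj _ sf); try fld; rewrite mulr0.
by rewrite !(gamma_dot _ sf); try fld.
Qed.

Lemma gammaZ (a : R) P : pvfield P -> gamma (a *: P) = a *: gamma P.
Proof. by apply: (gamma_scale (h := cst a)) => u; exact: (smooth_cst hB). Qed.

Lemma gammaN P : pvfield P -> gamma (- P) = - gamma P.
Proof. by move=> pP; rewrite -[- P]scaleN1r gammaZ // scaleN1r. Qed.

Lemma gammaB P Q : pvfield P -> pvfield Q -> gamma (P - Q) = gamma P - gamma Q.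
Proof. by move=> pP pQ; rewrite gammaD; try fld; rewrite gammaN. Qed.

Lemma rhoD X Y : rho (X + Y) = rho X + rho Y.
Proof.
apply/funext => u; apply/funext => f; rewrite fieldDE /rho /on_smooth.
by case: asboolP; rewrite ?fieldDE ?addr0.
Qed.

Lemma rho_scale h X : rho (fscale h X) = fscale h (rho X).
Proof.
apply/funext => u; apply/funext => f; rewrite fscaleE /rho /on_smooth.
by case: asboolP; rewrite ?fscaleE ?mulr0.
Qed.

Lemma rhoZ (a : R) X : rho (a *: X) = a *: rho X.
Proof. exact: (rho_scale (cst a)). Qed.

Lemma rhoN X : rho (- X) = - rho X.
Proof. by rewrite -[- X]scaleN1r rhoZ scaleN1r. Qed.

Lemma rhoB X Y : rho (X - Y) = rho X - rho Y.
Proof. by rewrite rhoD rhoN. Qed.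

Lemma pvfield0 : pvfield (0 : sTM -> (M -> R) -> R).
Proof. exact: (field0 hB hM). Qed.

Lemma rho_gamma P : pvfield P -> rho (gamma P) = 0.
Proof.
move=> pP; apply: pvfield_ext; [fld|exact: pvfield0|] => u f sf.
by rewrite (rhoE _ sf) (gamma_bproj pP sf).
Qed.

Lemma gamma0 : gamma (0 : sTM -> (M -> R) -> R) = 0.
Proof.
have pe := pvfield_eta.
by rewrite -[in LHS](subrr (@eta R n M A)) (gammaB pe pe) subrr.
Qed.

Lemma Jend_gamma P : pvfield P -> Jend (gamma P) = 0.
Proof. by move=> pP; rewrite /Jend (rho_gamma pP) gamma0. Qed.

Lemma JendD X Y : vfield X -> vfield Y -> Jend (X + Y) = Jend X + Jend Y.
Proof. by move=> vX vY; rewrite /Jend rhoD gammaD; try fld. Qed.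

Lemma JendB X Y : vfield X -> vfield Y -> Jend (X - Y) = Jend X - Jend Y.
Proof. by move=> vX vY; rewrite /Jend rhoB gammaB; try fld. Qed.

Lemma JendZ (a : R) X : vfield X -> Jend (a *: X) = a *: Jend X.
Proof. by move=> vX; rewrite /Jend rhoZ gammaZ; try fld. Qed.

Lemma Jend_scale h X : smooth B h -> vfield X ->
  Jend (fscale h X) = fscale h (Jend X).
Proof. by move=> sh vX; rewrite /Jend rho_scale gamma_scale; try fld. Qed.

(** * Brackets *)

Section Values.
Variables (u : sTM) (f : M -> R).
Hypothesis sf : smooth_at A (bproj u) f.

Lemma Jend_bproj X : vfield X -> Jend X u (f \o prj) = 0.
Proof. by move=> vX; apply: (gamma_bproj _ sf); fld. Qed.

Lemma Jend_dot X : vfield X -> Jend X u (dot f) = X u (f \o prj).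
Proof.
by move=> vX; rewrite -(rhoE X sf); apply: (gamma_dot _ sf); fld.
Qed.

Lemma bracketE_bproj X Y :
  bracket X Y u (f \o prj) = X u (der Y (f \o prj)) - Y u (der X (f \o prj)).
Proof. exact: (lieE _ _ (smooth_bproj hA sf)). Qed.

Lemma bracketE_dot X Y :
  bracket X Y u (dot f) = X u (der Y (dot f)) - Y u (der X (dot f)).
Proof. exact: (lieE _ _ (smooth_dot hA sf)). Qed.

Variable X : sTM -> (sTM -> R) -> R.
Hypothesis vX : vfield X.

Lemma der_gamma_bproj P : pvfield P -> X u (der (gamma P) (f \o prj)) = 0.
Proof.
move=> pP; rewrite -(tangent_cst hB (vX u).1 0); apply: (vect_near hB vX).
apply: near_at_sub (near_smooth_bproj sf) => u' su'.
exact: (gamma_bproj pP su').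
Qed.

Lemma der_gamma_dot P : pvfield P -> X u (der (gamma P) (dot f)) = X u (der P f).
Proof.
move=> pP; apply: (vect_near hB vX).
apply: near_at_sub (near_smooth_bproj sf) => u' su'; exact: (gamma_dot pP su').
Qed.

Lemma der_rho Y : X u (der (rho Y) f) = X u (der Y (f \o prj)).
Proof.
apply: (vect_near hB vX).
by apply: near_at_sub (near_smooth_bproj sf) => u' su'; rewrite [LHS]rhoE.
Qed.

Lemma der_Jend_bproj Y : vfield Y -> X u (der (Jend Y) (f \o prj)) = 0.
Proof. by move=> vY; apply: der_gamma_bproj; fld. Qed.

Lemma der_Jend_dot Y : vfield Y ->
  X u (der (Jend Y) (dot f)) = X u (der Y (f \o prj)).
Proof. by move=> vY; rewrite -der_rho; apply: der_gamma_dot; fld. Qed.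

Lemma der_liouville_bproj : X u (der (@liouville R n M A) (f \o prj)) = 0.
Proof. exact: (der_gamma_bproj pvfield_eta). Qed.

Lemma der_liouville_dot : X u (der (@liouville R n M A) (dot f)) = X u (dot f).
Proof. exact: (der_gamma_dot pvfield_eta). Qed.

End Values.

(** The Nijenhuis tensor of J vanishes: on f o pi both sides are 0, and on dot f
both are J X . (Y . (f o pi)) - J Y . (X . (f o pi)). *)
Lemma bracket_Jend X Y : vfield X -> vfield Y ->
  bracket (Jend X) (Jend Y) = Jend (bracket (Jend X) Y) + Jend (bracket X (Jend Y)).
Proof.
move=> vX vY; have vJX := vfield_Jend vX; have vJY := vfield_Jend vY.
have v1 := vfield_bracket vJX vY; have v2 := vfield_bracket vX vJY.
apply: vfield_ext; [fld|fld| |] => u f sf; rewrite fieldDE.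
  rewrite (bracketE_bproj sf) (Jend_bproj sf v1) (Jend_bproj sf v2).
  by rewrite (der_Jend_bproj sf vJX vY) (der_Jend_bproj sf vJY vX) subr0 addr0.
rewrite (bracketE_dot sf) (Jend_dot sf v1) (Jend_dot sf v2).
rewrite (der_Jend_dot sf vJX vY) (der_Jend_dot sf vJY vX) !(bracketE_bproj sf).
by rewrite (der_Jend_bproj sf vY vX) (der_Jend_bproj sf vX vY) subr0 sub0r.
Qed.

(** J is homogeneous of degree -1 in the fibre direction, since C . dot f = dot f. *)
Lemma bracket_liouville_Jend Y : vfield Y ->
  bracket (@liouville R n M A) (Jend Y) =
    Jend (bracket (@liouville R n M A) Y) - Jend Y.
Proof.
move=> vY; have vC := vfield_liouville; have vJY := vfield_Jend vY.
have v1 := vfield_bracket vC vY.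
apply: vfield_ext; [fld|fld| |] => u f sf; rewrite fieldDE fieldNE.
  rewrite (bracketE_bproj sf) (Jend_bproj sf v1) (Jend_bproj sf vY).
  by rewrite (der_Jend_bproj sf vC vY) (der_liouville_bproj sf vJY).
rewrite (bracketE_dot sf) (Jend_dot sf v1) (Jend_dot sf vY).
rewrite (der_Jend_dot sf vC vY) (der_liouville_dot sf vJY) (Jend_dot sf vY).
by rewrite (bracketE_bproj sf) (der_liouville_bproj sf vY) subr0.
Qed.

(** The fibres of the pullback bundle are constant along those of the slit
tangent bundle; this is the resulting flat derivative, with which every Berwald
connection agrees in vertical directions. *)
Definition vder P Q : sTM -> (M -> R) -> R :=
  fun u => on_smooth A (bproj u) (fun f => gamma P u (der Q f)).

Lemma vderE P Q u f : smooth_at A (bproj u) f -> vder P Q u f = gamma P u (der Q f).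
Proof. exact: on_smoothE. Qed.

Lemma vder_off P Q u f : ~ smooth_at A (bproj u) f -> vder P Q u f = 0.
Proof. by move=> sf; rewrite /vder /on_smooth asboolF. Qed.

(** Only one half of the bracket survives on f o pi, because gamma P kills it. *)
Lemma rho_bracket_gamma P Y : pvfield P -> vfield Y ->
  rho (bracket (gamma P) Y) = vder P (rho Y).
Proof.
move=> pP vY; have vP := vfield_gamma pP.
apply/funext => u; apply/funext => f.
have [sf|sf] := pselect (smooth_at A (bproj u) f); last first.
  by rewrite (vder_off _ _ sf) /rho /on_smooth asboolF.
rewrite (rhoE _ sf) (bracketE_bproj sf) (der_gamma_bproj sf vY pP) subr0.
by rewrite (vderE _ _ sf) (der_rho sf vP).
Qed.

Lemma vder_eta P : pvfield P -> vder P (@eta R n M A) = P.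
Proof.
move=> pP; apply/funext => u; apply/funext => f.
have [sf|sf] := pselect (smooth_at A (bproj u) f).
  by rewrite (vderE _ _ sf) -[RHS](gamma_dot pP sf).
by rewrite (vder_off _ _ sf) (tangent_off (pP u).1 sf).
Qed.

Lemma vderDl P P' Q : pvfield P -> pvfield P' ->
  vder (P + P') Q = vder P Q + vder P' Q.
Proof.
move=> pP pP'; apply/funext => u; apply/funext => f; rewrite fieldDE.
have [sf|sf] := pselect (smooth_at A (bproj u) f).
  by rewrite !(vderE _ _ sf) (gammaD pP pP').
by rewrite !(vder_off _ _ sf) addr0.
Qed.

Lemma vderDr P Q Q' : pvfield P -> pvfield Q -> pvfield Q' ->
  vder P (Q + Q') = vder P Q + vder P Q'.
Proof.
move=> pP pQ pQ'; have vP := vfield_gamma pP.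
apply/funext => u; apply/funext => f; rewrite fieldDE.
have [sf|sf] := pselect (smooth_at A (bproj u) f).
  by rewrite !(vderE _ _ sf) derDE (vectD hB vP ((pQ u).2 _ sf) ((pQ' u).2 _ sf)).
by rewrite !(vder_off _ _ sf) addr0.
Qed.

Lemma vder_scaler P Q h : pvfield P -> pvfield Q -> smooth B h ->
  vder P (fscale h Q) = fscale (der (gamma P) h) Q + fscale h (vder P Q).
Proof.
move=> pP pQ sh; have vP := vfield_gamma pP.
apply/funext => u; apply/funext => f; rewrite fieldDE !fscaleE.
have [sf|sf] := pselect (smooth_at A (bproj u) f).
  rewrite !(vderE _ _ sf) der_fscaleE (vectM hB vP (sh u) ((pQ u).2 _ sf)).
  by rewrite [LHS]addrC [_ * gamma P u h]mulrC.
by rewrite !(vder_off _ _ sf) (tangent_off (pQ u).1 sf) !mulr0 addr0.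
Qed.

Lemma bracket_gamma P Q : pvfield P -> pvfield Q -> pvfield (vder P Q) ->
  pvfield (vder Q P) ->
  bracket (gamma P) (gamma Q) = gamma (vder P Q - vder Q P).
Proof.
move=> pP pQ p1 p2; have vP := vfield_gamma pP; have vQ := vfield_gamma pQ.
have p3 : pvfield (vder P Q - vder Q P) by fld.
apply: vfield_ext; [fld|fld| |] => u f sf.
  rewrite (bracketE_bproj sf) (gamma_bproj p3 sf).
  by rewrite (der_gamma_bproj sf vP pQ) (der_gamma_bproj sf vQ pP) subr0.
rewrite (bracketE_dot sf) (gamma_dot p3 sf) fieldDE fieldNE !(vderE _ _ sf).
by rewrite (der_gamma_dot sf vP pQ) (der_gamma_dot sf vQ pP).
Qed.

Lemma liouville_poshom (l : tbundle A -> R) : smooth_poshom1 l ->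
  der (@liouville R n M A) (restr l) = restr l.
Proof. by move=> hl; apply/funext => u; exact: (vlift_poshom hA u hl). Qed.

Notation C := (@liouville R n M A).

Lemma Jend_Jend X : vfield X -> Jend (Jend X) = 0.
Proof. by move=> vX; apply: Jend_gamma; fld. Qed.

Lemma Jend_liouville : Jend C = 0.
Proof. exact: (Jend_gamma pvfield_eta). Qed.

Lemma JendN X : vfield X -> Jend (- X) = - Jend X.
Proof. by move=> vX; rewrite -[- X]scaleN1r (JendZ _ vX) scaleN1r. Qed.

Lemma gamma_rho X : gamma (rho X) = Jend X.
Proof. by []. Qed.

Lemma bracketE X Y u h : smooth_at B u h ->
  bracket X Y u h = X u (der Y h) - Y u (der X h).
Proof. exact: lieE. Qed.

Lemma bracketC X Y : vfield X -> vfield Y -> bracket X Y = - bracket Y X.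
Proof. exact: (lieC hB). Qed.

Lemma bracketBr X Y Z : vfield X -> vfield Y -> vfield Z ->
  bracket X (Y - Z) = bracket X Y - bracket X Z.
Proof. exact: (lieBr hB). Qed.

Lemma bracketBl X Y Z : vfield X -> vfield Y -> vfield Z ->
  bracket (X - Y) Z = bracket X Z - bracket Y Z.
Proof. exact: (lieBl hB). Qed.

Lemma bracketZr X Y (a : R) : vfield X -> vfield Y ->
  bracket X (a *: Y) = a *: bracket X Y.
Proof. exact: (lieZr hB). Qed.

Lemma bracket_fscale X Y h : vfield X -> vfield Y -> smooth B h ->
  bracket X (fscale h Y) = fscale (der X h) Y + fscale h (bracket X Y).
Proof. exact: (lie_fscale hB). Qed.

Lemma bracket_self X : vfield X -> bracket X X = 0.
Proof. exact: (lie_self hB). Qed.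

Lemma bracket0 X : vfield X -> bracket 0 X = 0.
Proof. exact: (lie0 hB). Qed.

Lemma bracket_jacobi X Y Z : vfield X -> vfield Y -> vfield Z ->
  bracket X (bracket Y Z) = bracket (bracket X Y) Z + bracket Y (bracket X Z).
Proof. exact: (jacobi hB). Qed.

Lemma gamma_eta : gamma (@eta R n M A) = C.
Proof. by []. Qed.

(* Turns the values of fields and functions into variables, so that a goal in R
is settled by arithmetic. *)
Ltac values := repeat match goal with
  | |- context [?X ?u ?h] => lazymatch type of X with
      | slit _ -> _ -> _ => let a := fresh "a" in generalize (X u h); intro a
      end
  | |- context [?h ?u] => lazymatch type of h with
      | slit _ -> _ => lazymatch type of (h u) with Real.sort _ =>
          let a := fresh "a" in generalize (h u); intro a
      end end
  end.
Ltac values_lra := values; intros; lra.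
Ltac values_ring := values; intros; ring.

(** * The canonical spray *)

Section CanonicalSpray.
Variables (L : tbundle A -> R) (hL : finsler L).
Notation En := (energy L).
Notation Om := (fundamental_form L).
Notation theta X := (der (Jend X) En).

Lemma smooth_energy : smooth B En.
Proof.
have [[sL _] _ _] := hL.
rewrite (_ : energy L = cst 2^-1 * (restr L * restr L)); last first.
  by apply/funext => u; rewrite /energy expr2.
move=> u; apply: (smoothM hB); first exact: (smooth_cst hB).
by apply: (smoothM hB); exact: sL.
Qed.

Lemma liouville_energy : der C En = En + En.
Proof.
have [hl _ _] := hL; have [sL _] := hl; have vC := vfield_liouville.
apply/funext => u.
have e : energy L = cst 2^-1 * (restr L * restr L).
  by apply/funext => u'; rewrite /energy expr2.
have lL : C u (restr L) = L u by exact: (vlift_poshom hA u hl).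
rewrite /der {1}e (vectM hB vC); last 2 first.
- exact: (smooth_cst hB).
- by apply: (smoothM hB); exact: sL.
rewrite (tangent_cst hB (vC u).1) mulr0 addr0 (vectM hB vC) ?lL; last 2 first.
- exact: sL.
- exact: sL.
rewrite -[RHS]/(2^-1 * L u ^+ 2 + 2^-1 * L u ^+ 2) expr2.
by rewrite -[LHS]/(2^-1 * (L u * L u + L u * L u)) mulrDr.
Qed.

Let sE u : smooth_at B u En := smooth_energy u.

Lemma smooth_theta X : vfield X -> smooth B (theta X).
Proof. by move=> vX; apply: smooth_der_vfield (vfield_Jend vX) smooth_energy. Qed.

Lemma OmE X Y u :
  Om X Y u = X u (theta Y) - Y u (theta X) - Jend (bracket X Y) u En.
Proof. by []. Qed.

Lemma vect_der0 X u : vfield X -> X u (der 0 En) = 0.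
Proof. by move=> vX; exact: (tangent_cst hB (vX u).1 0). Qed.

(** This holds because theta vanishes on the image of J and J has no Nijenhuis
torsion. *)
Lemma Om_Jend X Y u : vfield X -> vfield Y -> Om (Jend X) Y u = - Om X (Jend Y) u.
Proof.
move=> vX vY; have vJX := vfield_Jend vX; have vJY := vfield_Jend vY.
have e := congr1 (fun Z => Z u En) (bracket_Jend vX vY).
rewrite fieldDE (bracketE _ _ (sE u)) in e.
rewrite !OmE (Jend_Jend vX) (Jend_Jend vY) (vect_der0 u vX) (vect_der0 u vY).
by move: e; values_lra.
Qed.

(** L_C theta = theta: the energy is homogeneous of degree 2 and J of degree
-1. *)
Lemma theta_bracket_liouville Y : vfield Y ->
  theta (bracket C Y) = der C (theta Y) - theta Y.
Proof.
move=> vY; have vC := vfield_liouville; have vJY := vfield_Jend vY.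
apply/funext => u.
have e := congr1 (fun Z => Z u En) (bracket_liouville_Jend vY).
rewrite fieldDE fieldNE (bracketE _ _ (sE u)) liouville_energy in e.
rewrite (vectD hB vJY (sE u) (sE u)) in e.
rewrite -[RHS]/(C u (theta Y) - Jend Y u En) -[LHS]/(Jend (bracket C Y) u En).
by move: e; values_lra.
Qed.

Lemma Om_liouville Y u : vfield Y -> Om C Y u = Jend Y u En.
Proof.
move=> vY; have vC := vfield_liouville.
have e := congr1 (@^~ u) (theta_bracket_liouville vY).
rewrite -[LHS]/(Jend (bracket C Y) u En) in e.
rewrite OmE Jend_liouville (vect_der0 u vY) e.
rewrite -[(_ - _) u]/(C u (theta Y) - Jend Y u En).
by values_lra.
Qed.

(** L_C Omega = Omega, because Omega = d theta. *)
Lemma Om_bracket_liouville X Y u : vfield X -> vfield Y ->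
  Om (bracket C X) Y u = C u (Om X Y) - Om X (bracket C Y) u - Om X Y u.
Proof.
move=> vX vY; have vC := vfield_liouville.
have vCX := vfield_bracket vC vX; have vCY := vfield_bracket vC vY.
have vXY := vfield_bracket vX vY.
have sX := smooth_theta vX; have sY := smooth_theta vY.
have sXY := smooth_theta vXY.
have sXtY := smooth_der_vfield vX sY; have sYtX := smooth_der_vfield vY sX.
have sCX := smooth_der_vfield vC sX; have sCY := smooth_der_vfield vC sY.
have jac : Jend (bracket C (bracket X Y)) u En =
    Jend (bracket (bracket C X) Y) u En + Jend (bracket X (bracket C Y)) u En.
  rewrite -fieldDE -JendD; last 2 first.
  - by apply: vfield_bracket.
  - by apply: vfield_bracket.
  by congr (Jend _ u En); exact: bracket_jacobi.
have e := congr1 (@^~ u) (theta_bracket_liouville vXY).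
have eO : C u (Om X Y) = C u (der X (theta Y)) - C u (der Y (theta X)) -
    C u (theta (bracket X Y)).
  rewrite (_ : Om X Y = der X (theta Y) - der Y (theta X) - theta (bracket X Y)) //.
  rewrite (vectB hB vC _ (sXY u)); last exact: (smoothD hB (sXtY u) (smoothN hB (sYtX u))).
  by rewrite (vectB hB vC (sXtY u) (sYtX u)).
have eX : Y u (theta (bracket C X)) = Y u (der C (theta X)) - Y u (theta X).
  by rewrite (theta_bracket_liouville vX) (vectB hB vY (sCX u) (sX u)).
have eY : X u (theta (bracket C Y)) = X u (der C (theta Y)) - X u (theta Y).
  by rewrite (theta_bracket_liouville vY) (vectB hB vX (sCY u) (sY u)).
have eCX : bracket C X u (theta Y) = C u (der X (theta Y)) - X u (der C (theta Y)).
  exact: (bracketE _ _ (sY u)).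
have eCY : bracket C Y u (theta X) = C u (der Y (theta X)) - Y u (der C (theta X)).
  exact: (bracketE _ _ (sX u)).
have {}e : Jend (bracket C (bracket X Y)) u En =
  C u (theta (bracket X Y)) - Jend (bracket X Y) u En by exact: e.
rewrite (OmE (bracket C X) Y u) (OmE X (bracket C Y) u) (OmE X Y u).
by move: e eO eX eY eCX eCY jac; values_lra.
Qed.

Lemma OmB X X' Y u : vfield X -> vfield X' -> vfield Y ->
  Om (X - X') Y u = Om X Y u - Om X' Y u.
Proof.
move=> vX vX' vY; have v1 := vfield_bracket vX vY; have v2 := vfield_bracket vX' vY.
rewrite !OmE (JendB vX vX').
have -> : bracket (X - X') Y = bracket X Y - bracket X' Y by exact: bracketBl.
rewrite (JendB v1 v2) !fieldDE !fieldNE.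
have -> : Y u (der (Jend X - Jend X') En) = Y u (theta X) - Y u (theta X').
  exact: (vectB hB vY (smooth_theta vX u) (smooth_theta vX' u)).
by values_lra.
Qed.

Lemma Om_nondegenerate X X' : vfield X -> vfield X' ->
  (forall Y u, vfield Y -> Om X Y u = Om X' Y u) -> X = X'.
Proof.
move=> vX vX' e; apply/funext => u; apply/eqP; rewrite -subr_eq0; apply/eqP.
have [//|nz] := pselect (X u - X' u = 0).
have [_ _ nd] := hL.
have vXX : vfield (X - X') by fld.
have [Y vY] := nd u (X - X') vXX nz.
by rewrite OmB // e // subrr.
Qed.

Variables (G : sTM -> (sTM -> R) -> R) (hG : canonical_spray L G).

(** Moving J from G to the other argument of Omega shows i_(J G) Omega = d_J E,
which is also i_C Omega. *)
Lemma canonical_spray_Jend : Jend G = C.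
Proof.
have [vG GE] := hG; have vJG := vfield_Jend vG; have vC := vfield_liouville.
apply: (Om_nondegenerate vJG vC) => Y u vY; have vJY := vfield_Jend vY.
rewrite (Om_Jend u vG vY) (Om_liouville u vY) (GE _ vJY).
by rewrite -[LHS]/(- - der (Jend Y) En u) opprK.
Qed.

(** Since L_C Omega = Omega and L_C E = 2 E, the equation of the spray gives
i_[C, G] Omega = - 2 dE + dE = - dE. *)
Lemma canonical_spray_homogeneous : bracket C G = G.
Proof.
have [vG GE] := hG; have vC := vfield_liouville.
have vCG := vfield_bracket vC vG.
apply: (Om_nondegenerate vCG vG) => Y u vY; have vCY := vfield_bracket vC vY.
have sYE := smooth_der_vfield vY smooth_energy.
rewrite (Om_bracket_liouville u vG vY) (GE _ vY) (GE _ vCY).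
have -> : C u (- der Y En) = - C u (der Y En) by exact: (vectN hB vC (sYE u)).
rewrite -![(- der _ _) u]/(- (der _ _ u)).
have -> : der (bracket C Y) En u = C u (der Y En) - (Y u En + Y u En).
  rewrite -(vectD hB vY (sE u) (sE u)) -liouville_energy.
  exact: (bracketE _ _ (sE u)).
by rewrite /der; values_lra.
Qed.

End CanonicalSpray.

Lemma scale_half (V : lmodType R) (x : V) : 2^-1 *: x + 2^-1 *: x = x.
Proof. by rewrite -scalerDl -[2^-1]mul1r -splitr scale1r. Qed.

(** * The Barthel connection of a homogeneous spray *)

Section Spray.
Variable G : sTM -> (sTM -> R) -> R.
Hypotheses (vG : vfield G) (JG : Jend G = C) (CG : bracket C G = G).
Notation Gam := (barthel G).

Lemma rho_spray : rho G = @eta R n M A.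
Proof. by apply: gamma_inj; [fld|exact: pvfield_eta|exact: JG]. Qed.

Lemma rho_bracket_spray P : pvfield P -> rho (bracket (gamma P) G) = P.
Proof. by move=> pP; rewrite (rho_bracket_gamma pP vG) rho_spray (vder_eta pP). Qed.

Lemma vfield_barthel X : vfield X -> vfield (Gam X).
Proof. by move=> vX; rewrite /barthel; fld. Qed.

(** For vertical X the term [J X, G] is 0, and J [X, G] = X by
rho_bracket_spray. *)
Lemma barthel_gamma P : pvfield P -> Gam (gamma P) = - gamma P.
Proof.
move=> pP; rewrite /barthel (Jend_gamma pP) (bracket0 vG).
by rewrite -(gamma_rho (bracket _ _)) (rho_bracket_spray pP) sub0r.
Qed.

Lemma rho_barthel X : vfield X -> rho (Gam X) = rho X.
Proof.
move=> vX; have pX := pvfield_rho vX; have v1 := vfield_bracket vX vG.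
rewrite /barthel rhoB -(gamma_rho X) (rho_bracket_spray pX).
by rewrite -gamma_rho rho_gamma ?subr0 //; fld.
Qed.

Lemma barthelB X Y : vfield X -> vfield Y -> Gam (X - Y) = Gam X - Gam Y.
Proof.
move=> vX vY; have v1 := vfield_bracket vX vG; have v2 := vfield_bracket vY vG.
rewrite /barthel (JendB vX vY) (bracketBl (vfield_Jend vX) (vfield_Jend vY) vG).
by rewrite (bracketBl vX vY vG) (JendB v1 v2) !opprB addrACA [RHS]addrACA [- _ + _]addrC.
Qed.

Lemma vertical_barthel X : vfield X -> rho X = 0 -> Gam X = - X.
Proof. by move=> vX /(vertical_gamma vX)[P pP <-]; exact: barthel_gamma. Qed.

Lemma barthelN X : vfield X -> Gam (- X) = - Gam X.
Proof.
move=> vX; have v0 : vfield (X - X) by fld.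
have e0 : Gam (X - X) = 0 by rewrite (barthelB vX vX) subrr.
have := barthelB v0 vX; rewrite e0 sub0r => <-.
by rewrite subrr sub0r.
Qed.

Lemma barthelD X Y : vfield X -> vfield Y -> Gam (X + Y) = Gam X + Gam Y.
Proof.
move=> vX vY; have vN := vfieldN vY.
by rewrite -{1}[Y]opprK (barthelB vX vN) (barthelN vY) opprK.
Qed.

Lemma barthel_half X : vfield X -> Gam (2^-1 *: X) = 2^-1 *: Gam X.
Proof.
move=> vX; have vh : vfield (2^-1 *: X) by fld.
have e : X = 2^-1 *: X + 2^-1 *: X.
  by rewrite scale_half.
by rewrite {2}e (barthelD vh vh) scalerDr scale_half.
Qed.

(** Gamma is an involution: it is minus the identity on vertical vectors, and
X - Gamma X is vertical. *)
Lemma barthel_barthel X : vfield X -> Gam (Gam X) = X.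
Proof.
move=> vX; have vGX := vfield_barthel vX.
have vd : vfield (X - Gam X) by fld.
have rd : rho (X - Gam X) = 0 by rewrite rhoB (rho_barthel vX) subrr.
have := vertical_barthel vd rd; rewrite (barthelB vX vGX) [- (X - _)]opprB.
by move=> e2; exact: oppr_inj (addrI _ e2).
Qed.

Lemma barthel_spray : Gam G = G.
Proof.
rewrite /barthel JG CG (bracket_self vG) -[X in Jend X](subrr G).
by rewrite (JendB vG vG) subrr subr0.
Qed.

Lemma vfield_hproj X : vfield X -> vfield (hproj G X).
Proof. by move=> vX; have := vfield_barthel vX; rewrite /hproj => vGX; fld. Qed.

Lemma vfield_vproj X : vfield X -> vfield (vproj G X).
Proof. by move=> vX; have := vfield_barthel vX; rewrite /vproj => vGX; fld. Qed.

Lemma rho_hproj X : vfield X -> rho (hproj G X) = rho X.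
Proof.
by move=> vX; rewrite /hproj rhoZ rhoD (rho_barthel vX) scalerDr scale_half.
Qed.

Lemma rho_vproj X : vfield X -> rho (vproj G X) = 0.
Proof. by move=> vX; rewrite /vproj rhoZ rhoB (rho_barthel vX) subrr scaler0. Qed.

Lemma barthel_hproj X : vfield X -> Gam (hproj G X) = hproj G X.
Proof.
move=> vX; have vGX := vfield_barthel vX; have vD := vfieldD vX vGX.
by rewrite /hproj (barthel_half vD) (barthelD vX vGX) (barthel_barthel vX) addrC.
Qed.

Lemma hproj_vproj X : X = vproj G X + hproj G X.
Proof. by rewrite /vproj /hproj -scalerDr addrACA addNr addr0 scalerDr scale_half. Qed.

Lemma vproj_gamma P : pvfield P -> vproj G (gamma P) = gamma P.
Proof.
by move=> pP; rewrite /vproj (barthel_gamma pP) opprK scalerDr scale_half.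
Qed.

Lemma vprojB X Y : vfield X -> vfield Y -> vproj G (X - Y) = vproj G X - vproj G Y.
Proof.
by move=> vX vY; rewrite /vproj (barthelB vX vY) opprD addrACA -opprD scalerBr.
Qed.

(** The difference is vertical, hence reversed by Gamma, and also fixed by it. *)
Lemma horizontal_inj X Y : vfield X -> vfield Y -> Gam X = X -> Gam Y = Y ->
  rho X = rho Y -> X = Y.
Proof.
move=> vX vY hX hY e; have vd : vfield (X - Y) by fld.
have rd : rho (X - Y) = 0 by rewrite rhoB e subrr.
have := vertical_barthel vd rd; rewrite (barthelB vX vY) hX hY => e2.
apply/funext => u; apply/funext => h.
have := congr1 (fun Z => Z u h) e2; rewrite !fieldNE fieldDE fieldNE.
by values_lra.
Qed.

(** The field [gamma P, G] lifts P globally, and its horizontal part is the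
horizontal lift. *)
Lemma betaP P : pvfield P ->
  [/\ vfield (beta G P), rho (beta G P) = P & Gam (beta G P) = beta G P].
Proof.
move=> pP; have vP := vfield_gamma pP; have v1 := vfield_bracket vP vG.
suff : [set Z | (exists2 X, vfield X & Z = hproj G X) /\ rho Z = P] (beta G P).
  move=> [[X vX ->] rX]; split=> //; first exact: vfield_hproj.
  exact: barthel_hproj.
apply: xgetPex; exists (hproj G (bracket (gamma P) G)); split.
  by exists (bracket (gamma P) G).
by rewrite (rho_hproj v1) (rho_bracket_spray pP).
Qed.

Lemma vfield_beta P : pvfield P -> vfield (beta G P).
Proof. by case/betaP. Qed.

Lemma rho_beta P : pvfield P -> rho (beta G P) = P.
Proof. by case/betaP. Qed.

Lemma Jend_beta P : pvfield P -> Jend (beta G P) = gamma P.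
Proof. by move=> pP; rewrite -gamma_rho (rho_beta pP). Qed.

Lemma vproj_beta P : pvfield P -> vproj G (beta G P) = 0.
Proof. by case/betaP => _ _ e; rewrite /vproj e subrr scaler0. Qed.

Lemma betaE P X : pvfield P -> vfield X -> rho X = P -> vproj G X = 0 ->
  beta G P = X.
Proof.
move=> pP vX rX hX; have [vb rb hb] := betaP pP.
apply: horizontal_inj => //; last by rewrite rb rX.
have := hproj_vproj X; rewrite hX add0r => e.
by rewrite {1}e (barthel_hproj vX) -e.
Qed.

Lemma beta_rho X : vfield X -> beta G (rho X) = hproj G X.
Proof.
move=> vX; have vh := vfield_hproj vX.
apply: betaE => //; [fld|exact: rho_hproj|].
by rewrite /vproj (barthel_hproj vX) subrr scaler0.
Qed.

Lemma KmapP X : vfield X -> pvfield (Kmap G X) /\ gamma (Kmap G X) = vproj G X.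
Proof.
move=> vX; suff : [set P | pvfield P /\ gamma P = vproj G X] (Kmap G X) by [].
apply: xgetPex; have vv := vfield_vproj vX.
by have [P pP e] := vertical_gamma vv (rho_vproj vX); exists P.
Qed.

Lemma pvfield_Kmap X : vfield X -> pvfield (Kmap G X).
Proof. by case/KmapP. Qed.

Lemma gamma_Kmap X : vfield X -> gamma (Kmap G X) = vproj G X.
Proof. by case/KmapP. Qed.

Lemma KmapE X P : vfield X -> pvfield P -> gamma P = vproj G X -> Kmap G X = P.
Proof.
move=> vX pP e; apply: gamma_inj => //; first exact: pvfield_Kmap.
by rewrite (gamma_Kmap vX).
Qed.

Lemma gamma_beta_split X : vfield X -> X = gamma (Kmap G X) + beta G (rho X).
Proof. by move=> vX; rewrite (gamma_Kmap vX) (beta_rho vX) -hproj_vproj. Qed.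

Lemma pvfield_vder P Q : pvfield P -> pvfield Q -> pvfield (vder P Q).
Proof.
move=> pP pQ; have vP := vfield_gamma pP; have vQ := vfield_beta pQ.
by rewrite -(rho_beta pQ) -(rho_bracket_gamma pP vQ); fld.
Qed.

(** C acts on J by -J and fixes G, so it commutes with Gamma = [J, G] by the
Jacobi identity. *)
Lemma bracket_liouville_barthel X : vfield X ->
  bracket C (Gam X) = Gam (bracket C X).
Proof.
move=> vX; have vC := vfield_liouville; have vJX := vfield_Jend vX.
have vCX := vfield_bracket vC vX; have vXG := vfield_bracket vX vG.
have vJCX := vfield_Jend vCX.
have v1 := vfield_bracket vJX vG; have v2 := vfield_Jend vXG.
have v3 := vfield_bracket vCX vG.
rewrite /barthel (bracketBr vC v1 v2) (bracket_jacobi vC vJX vG) CG.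
rewrite (bracket_liouville_Jend vX) (bracketBl vJCX vJX vG) subrK.
rewrite (bracket_liouville_Jend vXG) (bracket_jacobi vC vX vG) CG (JendD v3 vXG).
by rewrite addrK.
Qed.

(** Horizontal fields are preserved by the flow of the Liouville field. *)
Lemma Kmap_bracket_beta_liouville P : pvfield P ->
  Kmap G (bracket (beta G P) C) = 0.
Proof.
move=> pP; have [vb _ hb] := betaP pP; have vC := vfield_liouville.
have v1 := vfield_bracket vb vC; have v2 := vfield_bracket vC vb.
apply: KmapE => //; first exact: pvfield0.
rewrite gamma0 (bracketC vb vC) /vproj (barthelN v2).
by rewrite -(bracket_liouville_barthel vb) hb opprK addNr scaler0.
Qed.

Section Berwald.
Variable D : (sTM -> (sTM -> R) -> R) -> (sTM -> (M -> R) -> R) ->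
  sTM -> (M -> R) -> R.
Hypothesis hD : berwald G D.

Lemma berwald_gamma P Q : pvfield P -> pvfield Q -> D (gamma P) Q = vder P Q.
Proof.
move=> pP pQ; have [_ /(_ P Q pP pQ)[-> _]] := hD.
by rewrite (rho_bracket_gamma pP (vfield_beta pQ)) (rho_beta pQ).
Qed.

Lemma berwald_split X Q : vfield X -> pvfield Q ->
  D X Q = vder (Kmap G X) Q + Kmap G (bracket (beta G (rho X)) (gamma Q)).
Proof.
move=> vX pQ; have pX := pvfield_rho vX; have pK := pvfield_Kmap vX.
have vb := vfield_beta pX; have vK := vfield_gamma pK.
have [[_ Dadd _ _ _] /(_ _ _ pX pQ)[_ <-]] := hD.
by rewrite {1}(gamma_beta_split vX) Dadd // (berwald_gamma pK pQ).
Qed.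

Lemma berwald_eta X : vfield X -> D X (@eta R n M A) = Kmap G X.
Proof.
move=> vX; have pX := pvfield_rho vX.
rewrite (berwald_split vX pvfield_eta) (vder_eta (pvfield_Kmap vX)).
by rewrite (Kmap_bracket_beta_liouville pX) addr0.
Qed.

End Berwald.
End Spray.

(** * Projective change of a spray *)

Section ProjectiveChange.
Variables G Gt : sTM -> (sTM -> R) -> R.
Hypotheses (vG : vfield G) (JG : Jend G = C) (CG : bracket C G = G).
Hypotheses (vGt : vfield Gt) (JGt : Jend Gt = C) (CGt : bracket C Gt = Gt).
Variables (l : tbundle A -> R) (hl : smooth_poshom1 l).
Notation lam := (restr l).

Let sl : smooth B lam := hl.1.
Let vC : vfield C := vfield_liouville.

Definition barthel_change := forall X, vfield X ->
  barthel Gt X = barthel G X -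
    2 *: (fscale lam (Jend X) + fscale (dJ lam X) C).

(** Gamma = [J, G] is linear in G, and [J, lambda C] = lambda J + d_J lambda C
because [J, C] = J and J C = 0. *)
Lemma spray_barthel_change : Gt = G - 2 *: fscale lam C -> barthel_change.
Proof.
move=> GtE X vX; rewrite GtE; have vJX := vfield_Jend vX.
have vlC : vfield (fscale lam C) by fld.
have v2 : vfield (2 *: fscale lam C) by fld.
have vXC := vfield_bracket vX vC; have vXG := vfield_bracket vX vG.
have vCX := vfield_bracket vC vX.
have sX := smooth_der_vfield vX sl.
have v3 : vfield (fscale (der X lam) C) by fld.
have v4 : vfield (fscale lam (bracket X C)) by fld.
have v5 := vfieldD v3 v4; have v6 := vfieldZ 2 v5.
rewrite /barthel (bracketBr vJX vG v2) (bracketZr 2 vJX vlC).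
rewrite (bracket_fscale vJX vC sl) (bracketBr vX vG v2) (bracketZr 2 vX vlC).
rewrite (bracket_fscale vX vC sl) (JendB vXG v6) (JendZ 2 v5) (JendD v3 v4).
rewrite (Jend_scale sX vC) (Jend_scale sl vXC) Jend_liouville.
rewrite (bracketC vJX vC) (bracket_liouville_Jend vX) (bracketC vX vC) (JendN vCX).
apply/funext => u; apply/funext => h; rewrite /dJ !fieldE.
by values_ring.
Qed.

(** Evaluate the two connections on G, which is horizontal for Gamma while
Gt - G is vertical. *)
Lemma barthel_change_spray : barthel_change -> Gt = G - 2 *: fscale lam C.
Proof.
move=> /(_ _ vG); rewrite (barthel_spray vG JG CG) /dJ JG (liouville_poshom hl) => e1.
have vd : vfield (Gt - G) by fld.
have rd : rho (Gt - G) = 0 by rewrite rhoB (rho_spray vG JG) (rho_spray vGt JGt) subrr.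
have := vertical_barthel vGt JGt vd rd.
rewrite (barthelB vGt vGt vG) (barthel_spray vGt JGt CGt) e1 => e2.
apply/funext => u; apply/funext => h.
have := congr1 (fun Z => Z u h) e2; rewrite !fieldE.
by values_lra.
Qed.

(** The amount by which a projective change moves K, and beta in the opposite
direction. *)
Definition shift P : sTM -> (M -> R) -> R :=
  fscale lam P + fscale (der (gamma P) lam) (@eta R n M A).

Lemma pvfield_shift P : pvfield P -> pvfield (shift P).
Proof. by move=> pP; have vP := vfield_gamma pP; rewrite /shift; fld. Qed.

Lemma gamma_shift P : pvfield P ->
  gamma (shift P) = fscale lam (gamma P) + fscale (der (gamma P) lam) C.
Proof.
move=> pP; have vP := vfield_gamma pP; have pe := pvfield_eta.
have sP := smooth_der_vfield vP sl.
by rewrite /shift gammaD; try fld; rewrite (gamma_scale sl pP) (gamma_scale sP pe).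
Qed.

Lemma shiftN P : pvfield P -> shift (- P) = - shift P.
Proof.
move=> pP; rewrite /shift (gammaN pP) derNE.
apply/funext => u; apply/funext => f; rewrite !fieldE.
rewrite -[(- der _ _) u]/(- der (gamma P) lam u).
by values_ring.
Qed.

Lemma barthel_change_vproj : barthel_change <-> forall X, vfield X ->
  vproj Gt X = vproj G X + gamma (shift (rho X)).
Proof.
split=> h X vX; have := h X vX; have pX := pvfield_rho vX;
    rewrite (gamma_shift pX) gamma_rho /dJ /vproj => e;
    apply/funext => u; apply/funext => f;
    have := congr1 (fun Z => Z u f) e; rewrite !fieldE; values_lra.
Qed.

Section Change.
Hypothesis hV : forall X, vfield X ->
  vproj Gt X = vproj G X + gamma (shift (rho X)).

Lemma beta_change P : pvfield P -> beta Gt P = beta G P - gamma (shift P).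
Proof.
move=> pP; have pS := pvfield_shift pP; have vS := vfield_gamma pS.
have vb := vfield_beta vG JG pP.
apply: (betaE vGt JGt pP); first by fld.
  by rewrite rhoB (rho_beta vG JG pP) (rho_gamma pS) subr0.
rewrite (vprojB vGt vb vS) (vproj_gamma vGt JGt pS) (hV vb).
by rewrite (vproj_beta vG JG pP) (rho_beta vG JG pP) add0r subrr.
Qed.

Lemma Kmap_change X : vfield X -> Kmap Gt X = Kmap G X + shift (rho X).
Proof.
move=> vX; have pS := pvfield_shift (pvfield_rho vX).
have pK := pvfield_Kmap vG JG vX.
apply: (KmapE vGt JGt vX); first by fld.
by rewrite (gammaD pK pS) (gamma_Kmap vG JG vX) (hV vX).
Qed.

End Change.

Section BerwaldChange.
Variables D Dt : (sTM -> (sTM -> R) -> R) -> (sTM -> (M -> R) -> R) ->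
  sTM -> (M -> R) -> R.
Hypotheses (hD : berwald G D) (hDt : berwald Gt Dt).
Let alpha P := dJ lam (beta G P).

Definition berwald_change := forall X P, vfield X -> pvfield P ->
  Dt X P = D X P + fscale (alpha P) (rho X) + fscale (alpha (rho X)) P +
    fscale (vcov D alpha P (rho X)) (@eta R n M A).

Lemma alphaE P : pvfield P -> alpha P = der (gamma P) lam.
Proof. by move=> pP; rewrite /alpha /dJ (Jend_beta vG JG pP). Qed.

Lemma vcov_alphaE P Q : pvfield P -> pvfield Q ->
  vcov D alpha P Q =
    der (gamma P) (der (gamma Q) lam) - der (gamma (vder P Q)) lam.
Proof.
move=> pP pQ; have pV := pvfield_vder vG JG pP pQ.
by rewrite /vcov (berwald_gamma vG JG hD pP pQ) (alphaE pQ) (alphaE pV).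
Qed.

(** With S for shift and Q = rho X, the two summands of berwald_split change by
vder (S Q) P and by - S (vder P Q) - vder (S Q) P + vder P (S Q); the terms
vder (S Q) P cancel. *)
Lemma barthel_berwald_change : barthel_change -> berwald_change.
Proof.
move=> /barthel_change_vproj hV X P vX pP.
have pQ := pvfield_rho vX; set Q := rho X in pQ *.
have vP := vfield_gamma pP; have vQ := vfield_gamma pQ.
have pS := pvfield_shift pQ; have vS := vfield_gamma pS.
have pK := pvfield_Kmap vG JG vX.
have vb := vfield_beta vG JG pQ; have vW := vfield_bracket vb vP.
have pV := pvfield_vder vG JG pP pQ.
have p1 := pvfield_vder vG JG pS pP; have p2 := pvfield_vder vG JG pP pS.
have pZ : pvfield (vder (shift Q) P - vder P (shift Q)) by fld.
have vZ := vfield_gamma pZ.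
have rW : rho (bracket (beta G Q) (gamma P)) = - vder P Q.
  by rewrite (bracketC vb vP) rhoN (rho_bracket_gamma pP vb) (rho_beta vG JG pQ).
have pSV := pvfield_shift (pvfieldN pV).
have pKW := pvfield_Kmap vG JG vW.
have eK : Kmap Gt (bracket (beta Gt Q) (gamma P)) =
    Kmap G (bracket (beta G Q) (gamma P)) + shift (- vder P Q) -
    (vder (shift Q) P - vder P (shift Q)).
  rewrite (beta_change hV pQ) (bracketBl vb vS vP) (bracket_gamma pS pP p1 p2).
  have p3 := pvfieldD pKW pSV.
  apply: (KmapE vGt JGt); [fld|fld|].
  rewrite (gammaB p3 pZ) (gammaD pKW pSV) (gamma_Kmap vG JG vW).
  by rewrite (vprojB vGt vW vZ) (vproj_gamma vGt JGt pZ) (hV _ vW) rW.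
have sQ := smooth_der_vfield vQ sl.
have pe := pvfield_eta.
have p4 := pvfield_scale sl pQ; have p5 := pvfield_scale sQ pe.
have eS : vder P (shift Q) = fscale (der (gamma P) lam) Q + fscale lam (vder P Q) +
    (fscale (der (gamma P) (der (gamma Q) lam)) (@eta R n M A) +
     fscale (der (gamma Q) lam) P).
  rewrite /shift (vderDr pP p4 p5) (vder_scaler pP pQ sl).
  by rewrite (vder_scaler pP pe sQ) (vder_eta pP).
rewrite (vcov_alphaE pP pQ) (alphaE pP) (alphaE pQ).
rewrite (berwald_split vGt JGt hDt vX pP) (berwald_split vG JG hD vX pP) -/Q.
rewrite eK (Kmap_change hV vX) (vderDl _ pK pS) (shiftN pV) eS /shift.
apply/funext => u; apply/funext => f; rewrite !fieldE.
rewrite -[(_ - der (gamma (vder P Q)) lam) u]/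
  (der (gamma P) (der (gamma Q) lam) u - der (gamma (vder P Q)) lam u).
by values_ring.
Qed.

(** alpha is homogeneous of degree 0: apply [C, gamma Q] = gamma (vder eta Q - Q)
to lambda, which is homogeneous of degree 1. *)
Lemma vcov_alpha_eta Q : pvfield Q -> vcov D alpha (@eta R n M A) Q = 0.
Proof.
move=> pQ; have pe := pvfield_eta; have vQ := vfield_gamma pQ.
have pV := pvfield_vder vG JG pe pQ; have pV' := pvfield_vder vG JG pQ pe.
have e := bracket_gamma pe pQ pV pV'.
rewrite (vder_eta pQ) (gammaB pV pQ) gamma_eta in e.
rewrite (vcov_alphaE pe pQ) gamma_eta; apply/funext => u.
have := congr1 (fun Z => Z u lam) e.
rewrite (bracketE _ _ (sl u)) (liouville_poshom hl) fieldDE fieldNE.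
rewrite -[(_ - _) u]/(C u (der (gamma Q) lam) - gamma (vder _ Q) u lam).
rewrite -[(0 : sTM -> R) u]/(0 : R).
by values_lra.
Qed.

(** Each Berwald connection takes eta to its own K, so (c) at eta compares the
two vertical projections. *)
Lemma berwald_barthel_change : berwald_change -> barthel_change.
Proof.
move=> hc; apply/barthel_change_vproj => X vX.
have pe := pvfield_eta; have pX := pvfield_rho vX.
have pK := pvfield_Kmap vG JG vX; have pS := pvfield_shift pX.
have := hc X _ vX pe.
rewrite (berwald_eta vGt JGt CGt hDt vX) (berwald_eta vG JG CG hD vX).
rewrite (vcov_alpha_eta pX) (alphaE pe) (alphaE pX) gamma_eta (liouville_poshom hl).
move=> e; rewrite -(gamma_Kmap vGt JGt vX) -(gamma_Kmap vG JG vX) -(gammaD pK pS).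
congr gamma; rewrite e /shift.
apply/funext => u; apply/funext => f; rewrite !fieldE.
rewrite -[(0 : sTM -> R) u]/(0 : R).
by values_ring.
Qed.

End BerwaldChange.
End ProjectiveChange.

End SlitFields.

Theorem theorem2p5 (R : realType) (n : nat) (M : topologicalType)
    (A : set (chart 'rV[R]_n M)) (hM : smooth_manifold A)
    (L Lt : tbundle A -> R) (hL : finsler L) (hLt : finsler Lt)
    (G Gt : slit A -> (slit A -> R) -> R)
    (hG : canonical_spray L G) (hGt : canonical_spray Lt Gt)
    (D Dt : (slit A -> (slit A -> R) -> R) -> (slit A -> (M -> R) -> R) ->
            slit A -> (M -> R) -> R)
    (hD : berwald G D) (hDt : berwald Gt Dt) :
  (projectively_related G Gt <-> barthel_projective G Gt) /\
  (barthel_projective G Gt <-> berwald_projective G D Dt).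
Proof.
have [_ _ hA] := hM.
have vG := hG.1; have vGt := hGt.1.
have JG := canonical_spray_Jend hA hL hG.
have JGt := canonical_spray_Jend hA hLt hGt.
have CG := canonical_spray_homogeneous hA hL hG.
have CGt := canonical_spray_homogeneous hA hLt hGt.
split; split=> -[l hl h]; exists l => //.
- exact: (spray_barthel_change hA vG hl h).
- exact: (barthel_change_spray hA vG JG CG vGt JGt CGt hl h).
- exact: (barthel_berwald_change hA vG JG vGt JGt hl hD hDt h).
- exact: (berwald_barthel_change hA vG JG CG vGt JGt CGt hl hD hDt h).
Qed.
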